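(* Suppose that $(X_n,\eta_n)$ is a time-homogeneous, irreducible Markov chain on the half strip $\Sigma$ and that all of the following hold. (1) For some $p>2$ there is a constant $C_p<\infty$ such that $\mathbb{E}_{x,i}[|X_{n+1}-X_n|^p]\le C_p$ for all $(x,i)\in\Sigma$ and all $n$. (2) For $i,j\in S$ there exist $\gamma_{ij}\in\mathbb{R}$ such that $q_{ij}(x)=q_{ij}+\frac{\gamma_{ij}}{x}+o(x^{-1})$ as $x\to\infty$, where $(q_{ij})_{i,j\in S}$ is an irreducible stochastic matrix; let $(\pi_i)_{i\in S}$ be its unique stationary distribution. (3) For $i,j\in S$ there exist $d_i,e_i,d_{ij}\in\mathbb{R}$ and $t_i^2\in[0,\infty)$, with at least one $t_i^2$ non-zero, such that, as $x\to\infty$, $\mu_i(x)=d_i+\frac{e_i}{x}+o(x^{-1})$, $\sigma_i^2(x)=t_i^2+o(1)$ and $\mu_{ij}(x)=d_{ij}+o(1)$; and moreover $\sum_{i\in S}\pi_id_i=0$. Let $(a_i)_{i\in S}$ be a solution of the system $$d_i+\sum_{j\in S}(a_j-a_i)q_{ij}=0\quad\text{for all } i\in S$$ (a solution exists and is unique up to adding a common constant to all $a_i$). Define $$U=\sum_{i\in S}\Big(2e_i+2\sum_{j\in S}a_j\gamma_{ij}\Big)\pi_i,\qquad V=\sum_{i\in S}\Big(t_i^2+2\sum_{j\in S}a_jd_{ij}\Big)\pi_i.$$ If for some $\theta\in(0,\frac p2]$ we have $U+(2\theta-1)V>0$, then for any $s\ge\theta$ we have $\mathbb{E}[\tau_x^s]=\infty$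 for all $x$ sufficiently large, whenever the chain starts from a fixed initial state $(X_0,\eta_0)$ with $X_0>x$ sufficiently large (depending on $x$).
   Context: $S$ is a finite non-empty set, and $\Sigma\subset[0,\infty)\times S$ is locally finite, meaning that $\Sigma\cap([0,c]\times S)$ is finite for every $c\ge 0$. For each $k\in S$ the line $\Lambda_k=\{x\ge 0:(x,k)\in\Sigma\}$ is unbounded. The chain is $(X_n,\eta_n)$, $n\in\{0,1,2,\dots\}$, with $X_n\in[0,\infty)$ and $\eta_n\in S$. Notation: for $(x,i)\in\Sigma$, $\mathbb{E}_{x,i}[\,\cdot\,]=\mathbb{E}[\,\cdot\mid X_n=x,\eta_n=i]$; $\mu_i(x)=\mathbb{E}_{x,i}[X_{n+1}-X_n]$; $\sigma_i^2(x)=\mathbb{E}_{x,i}[(X_{n+1}-X_n)^2]$; $\mu_{ij}(x)=\mathbb{E}_{x,i}[(X_{n+1}-X_n)\mathbf{1}\{\eta_{n+1}=j\}]$; $q_{ij}(x)=\mathbb{P}[\eta_{n+1}=j\mid X_n=x,\eta_n=i]$. All asymptotics as $x\to\infty$ for quantities on line $i$ are along $x\in\Lambda_i$. For $x\ge 0$, $\tau_x=\min\{n\ge 0:X_n\le x\}$ (with $\min\emptyset=\infty$). *)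

(* Defs.v *)
From HB Require Import structures.
From mathcomp Require Import all_boot all_order all_algebra.
From mathcomp Require Import all_classical all_reals all_analysis.

Set Implicit Arguments.
Unset Strict Implicit.
Unset Printing Implicit Defensive.

Import Order.TTheory GRing.Theory Num.Theory.
Import numFieldNormedType.Exports.

Local Open Scope classical_set_scope.
Local Open Scope ring_scope.

(* The carrier R * S of the half strip, with the discrete sigma-algebra.  The
   chains below live on a countable subset Sigma of it, so measurability of a
   Sigma-valued variable just means that its point events are measurable.  The
   point s0 is only there because a measurableType must be inhabited; it
   witnesses that S is non-empty. *)
Definition strip (R : realType) (S : finType) (s0 : S) : Type := (R * S)%type.

Section strip_instances.
Variables (R : realType) (S : finType) (s0 : S).
HB.instance Definition _ := Choice.copy (strip R s0) (R * S)%type.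
HB.instance Definition _ := isPointed.Build (strip R s0) (0, s0).
HB.instance Definition _ := @isMeasurable.Build default_measure_display
  (strip R s0) discrete_measurable discrete_measurable0
  discrete_measurableC discrete_measurableU.
End strip_instances.

(* A time-homogeneous transition law: K z is the law of the state at time n + 1
   given that the state at time n is z, for every n.  Only its values at points
   of Sigma are meaningful; no measurability in z is needed, the sigma-algebra
   being discrete. *)
Definition transition_law (R : realType) (S : finType) (s0 : S) :=
  strip R s0 -> probability (strip R s0) R.

Section half_strip.
Context {R : realType} {S : finType} {s0 : S}.
Local Notation T := (strip R s0).

Definition line (Sigma : set T) (i : S) : set R := [set x | Sigma (x, i)].

Record half_strip (Sigma : set T) : Prop := HalfStrip {
  strip_ge0 : forall z, Sigma z -> 0 <= z.1 ;
  strip_locally_finite :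
    forall c : R, 0 <= c -> finite_set (Sigma `&` [set z | z.1 <= c]) ;
  line_unbounded : forall k, ~ has_ubound (line Sigma k) }.

Definition law_on (Sigma : set T) (K : transition_law R s0) : Prop :=
  forall z, Sigma z -> K z Sigma = 1%E.

Fixpoint nstep (K : transition_law R s0) (n : nat) (z w : T) : \bar R :=
  if n is m.+1 then (\int[K z]_u nstep K m u w)%E else ((z == w)%:R)%:E.

Definition irreducible_law (Sigma : set T) (K : transition_law R s0) : Prop :=
  forall z w, Sigma z -> Sigma w -> exists n, (0 < nstep K n z w)%E.

(* The Markov property is written with the conditional probability multiplied
   out: P(Z_0 = u_0, .., Z_n+1 = u_n+1)
        = P(Z_0 = u_0, .., Z_n = u_n) * K(u_n, u_n+1). *)
Record markov_chain (Sigma : set T) (K : transition_law R s0) (z0 : T)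
    (d : measure_display) (Omega : measurableType d) (P : probability Omega R)
    (Z : nat -> {RV P >-> T}) : Prop := MarkovChain {
  chain_in : forall n w, Sigma (Z n w) ;
  chain_start : P (Z 0%N @^-1` [set z0]) = 1%E ;
  chain_markov : forall (n : nat) (u : nat -> T),
    (P (\bigcap_(k in `I_n.+2) (Z k @^-1` [set u k])) =
     P (\bigcap_(k in `I_n.+1) (Z k @^-1` [set u k])) * K (u n) [set u n.+1])%E
  }.

(* Since K (x, i) is the conditional law of (X_n+1, eta_n+1) given
   (X_n, eta_n) = (x, i), the expectation E_{x,i} of a function of the increment
   and of eta_n+1 is an expectation under K (x, i).  The real-valued moments
   below use [fine]; they are only used when the moment of order p > 2 of the
   increment is finite, so that no infinite value is hidden. *)
Definition Eincr (K : transition_law R s0) (i : S) (x : R) (f : R -> S -> R) :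
  \bar R := ('E_(K (x, i))[(fun z : T => f (z.1 - x) z.2)%R])%E.

Definition mu (K : transition_law R s0) (i : S) (x : R) : R :=
  fine (Eincr K i x (fun D _ => D)).

Definition sigma2 (K : transition_law R s0) (i : S) (x : R) : R :=
  fine (Eincr K i x (fun D _ => D ^+ 2)).

Definition muj (K : transition_law R s0) (i j : S) (x : R) : R :=
  fine (Eincr K i x (fun D k => D * (k == j)%:R)).

Definition qj (K : transition_law R s0) (i j : S) (x : R) : R :=
  fine (K (x, i) [set z | z.2 = j]).

End half_strip.

Definition line_infty (R : realType) (S : finType) (s0 : S)
  (Sigma : set (strip R s0)) (i : S) : set_system R :=
  within (line Sigma i) (pinfty_nbhs R).

Canonical line_infty_filter (R : realType) (S : finType) (s0 : S)
    (Sigma : set (strip R s0)) (i : S) :=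
  FilterType (line_infty Sigma i) (within_filter _ _).

Section stochastic.
Context {R : realType} {S : finType}.

Definition stochastic (q : S -> S -> R) : Prop :=
  (forall i j, 0 <= q i j) /\ (forall i, \sum_j q i j = 1).

Fixpoint mpow (q : S -> S -> R) (n : nat) (i j : S) : R :=
  if n is m.+1 then \sum_k q i k * mpow q m k j else (i == j)%:R.

Definition irreducible_matrix (q : S -> S -> R) : Prop :=
  forall i j, exists n, 0 < mpow q n i j.

Definition stationary (q : S -> S -> R) (pi : S -> R) : Prop :=
  [/\ forall i, 0 <= pi i, \sum_i pi i = 1 &
      forall j, \sum_i pi i * q i j = pi j].

Definition Uconst (e a pi : S -> R) (gamma : S -> S -> R) : R :=
  \sum_i (2 * e i + 2 * \sum_j a j * gamma i j) * pi i.

Definition Vconst (t2 a pi : S -> R) (dd : S -> S -> R) : R :=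
  \sum_i (t2 i + 2 * \sum_j a j * dd i j) * pi i.

End stochastic.

(* First passage time: a non-empty infimum of naturals is attained, and the
   infimum of the empty set is +oo. *)
Definition tau (R : realType) (X : nat -> R) (x : R) : \bar R :=
  ereal_inf [set (n%:R)%:E | n in [set n | X n <= x]].

(* Main.v *)
Require Import Defs.
From HB Require Import structures.
From mathcomp Require Import all_boot all_order all_algebra.
From mathcomp Require Import all_classical all_reals all_analysis.
From mathcomp Require Import measurable_realfun ring lra.

Set Implicit Arguments.
Unset Strict Implicit.
Unset Printing Implicit Defensive.

Import Order.TTheory GRing.Theory Num.Theory.
Import numFieldNormedType.Exports.

Local Open Scope classical_set_scope.
Local Open Scope ring_scope.

(** Put nu = 2 theta.  The proof compares two facts: a function that grows like
    x ^ nu is a submartingale outside a bounded set, and coming back from a high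
    level y takes a time of order y ^ 2.

    The submartingale is h (x, i) = x ^ nu + nu a_i x ^ (nu - 1)
    + b_i x ^ (nu - 2), cut off at zero.  By Taylor expansion its drift on line i
    has no term of order x ^ (nu - 1), thanks to the equation for a, and the
    coefficient of x ^ (nu - 2) is c_i + sum_j q_ij b_j - b_i, where c_i collects
    the second order data of line i.  The stationary mean of c is
    theta (U + (2 theta - 1) V) > 0, so solving the Poisson equation for b
    ([poisson_equation]) makes the coefficient equal to this positive number on
    all lines at once ([lyapunov_submartingale]).  Since h is non-negative,
    jumps longer than half of the current level need no expansion: they cost at
    most h times their probability, which is O (x ^ (nu - p)) with p > 2.

    The return time is estimated from the transition law alone.  The corrected
    position x + a_i has drift O (1 / x) and its increments have bounded second
    moments, so its squared displacement grows at most linearly, and a Chebyshev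
    estimate, run as an induction on the number of steps, shows that
    descending from y to y / 2 within eps y ^ 2 steps has probability at most one
    half ([survival_quadratic]).

    Suppose now that E [tau_x ^ s] is finite for some s >= theta.  Let
    m = C x ^ nu be a bound for h below x and g = (h - m)^+, which vanishes below
    x and inherits the submartingale property above it.  By the Markov property
    at time n and the return time bound, E [tau_x ^ s; tau_x > n] is at least a
    constant times E [g (Z_n); tau_x > n], which is at least g (z0) for every n.
    But E [tau_x ^ s; tau_x > n] tends to zero as n grows, while g (z0) > 0 as
    soon as the starting level is high enough ([passage_moment_infinite]). *)

(** * The Poisson equation of an irreducible stochastic matrix *)

Section poisson.
Context {R : realType} {S : finType}.
Implicit Types (q : S -> S -> R) (pi b c : S -> R).

Lemma mpow_ge0 q n i j : stochastic q -> 0 <= mpow q n i j.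
Proof.
move=> [q0 _]; elim: n i => [|n IH] i /=; first exact: ler0n.
by apply: sumr_ge0 => k _; rewrite mulr_ge0.
Qed.

Lemma sum_mpow q n i : stochastic q -> \sum_j mpow q n i j = 1.
Proof.
move=> [_ q1]; elim: n i => [|n IH] i /=.
  rewrite (bigD1 i)//= eqxx big1 ?addr0// => j ji.
  by rewrite eq_sym (negbTE ji).
rewrite exchange_big/= -[RHS](q1 i); apply: eq_bigr => k _.
by rewrite -mulr_sumr IH mulr1.
Qed.

Lemma harmonic_mpow q b n i :
  (forall i, \sum_j q i j * b j = b i) -> \sum_j mpow q n i j * b j = b i.
Proof.
move=> hb; elim: n i => [|n IH] i /=.
  rewrite (bigD1 i)//= eqxx mul1r big1 ?addr0// => j ji.
  by rewrite eq_sym (negbTE ji) mul0r.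
under eq_bigr do rewrite mulr_suml.
rewrite exchange_big/= -[RHS]hb; apply: eq_bigr => k _.
by rewrite -IH mulr_sumr; apply: eq_bigr => j _; rewrite mulrA.
Qed.

(** The maximum principle: the average defining the value at a maximum point
    gives positive weight to every point that can be reached. *)
Lemma harmonic_constant q b : stochastic q -> irreducible_matrix q ->
  (forall i, \sum_j q i j * b j = b i) -> forall i j, b i = b j.
Proof.
move=> sq iq hb i0 j0.
pose m := [arg max_(k > i0) b k]%O.
have mP k : b k <= b m by rewrite /m; case: arg_maxP => // x _; exact.
suff H k : b k = b m by rewrite !H.
have [n nP] := iq m k.
have : \sum_j mpow q n m j * (b m - b j) = 0.
  under eq_bigr do rewrite mulrBr.
  by rewrite big_split/= sumrN -mulr_suml sum_mpow// mul1r harmonic_mpow// subrr.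
move/eqP; rewrite psumr_eq0; last first.
  by move=> j _; rewrite mulr_ge0 ?mpow_ge0// subr_ge0.
move/allP/(_ k); rewrite mem_index_enum => /(_ isT)/=.
by rewrite mulf_eq0 gt_eqF//= subr_eq0 => /eqP.
Qed.

(** The kernel of Q - 1 consists of the constants, so its image is a hyperplane.
    It is orthogonal to the stationary distribution, hence contains no non-zero
    constant, and every c is a constant plus an element of the image. *)
Lemma poisson_equation q pi c : stochastic q -> irreducible_matrix q ->
  stationary q pi ->
  exists b, forall i, \sum_j q i j * b j - b i + c i = \sum_k pi k * c k.
Proof.
move=> sq iq [pi0 pi1 piq].
pose n := #|S|.
(* Transposed, because the kernel and image of a matrix are about row vectors. *)
pose A : 'M[R]_n := \matrix_(i, j)
  (q (enum_val j) (enum_val i) - (i == j)%:R).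
pose B : 'rV[R]_n := const_mx 1.
pose of_row (v : 'rV[R]_n) (i : S) := v 0 (enum_rank i).
have mulA v k : (v *m A) 0 k =
    \sum_j q (enum_val k) j * of_row v j - of_row v (enum_val k).
  rewrite mxE /of_row enum_valK.
  under eq_bigr do rewrite mxE mulrBr.
  rewrite big_split/= sumrN; congr (_ - _).
    rewrite (reindex (@enum_rank S))/=; last exact: onW_bij (enum_rank_bij _).
    by apply: eq_bigr => j _; rewrite mulrC enum_rankK.
  rewrite (bigD1 k)//= eqxx mulr1 big1 ?addr0// => j jk.
  by rewrite (negbTE jk) mulr0.
have piA v : \sum_i pi i * (\sum_j q i j * of_row v j - of_row v i) = 0.
  under eq_bigr do rewrite mulrBr mulr_sumr.
  rewrite big_split/= sumrN exchange_big/= -sumrB big1// => j _.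
  rewrite -[pi j]piq mulr_suml -sumrB big1// => i _.
  by rewrite mulrA subrr.
have kerA : (kermx A <= B)%MS.
  apply/rV_subP => v /sub_kermxP vA.
  have hv i : \sum_j q i j * of_row v j = of_row v i.
    apply/eqP; rewrite -subr_eq0; move/rowP: vA => /(_ (enum_rank i)).
    by rewrite mulA enum_rankK mxE => ->.
  have cst := harmonic_constant sq iq hv.
  have [i _|S0] := pickP (fun _ : S => true); last first.
    have n0 : n = 0%N.
      apply/eqP; rewrite -leqn0 leqNgt; apply/negP => /card_gt0P[i] _.
      by have := S0 i.
    suff -> : v = 0 by exact: sub0mx.
    by apply/rowP => k; have := ltn_ord k; rewrite [X in (_ < X)%N]n0.
  suff -> : v = of_row v i *: B by exact: scalemx_sub.
  by apply/rowP => k; rewrite !mxE mulr1 (cst i (enum_val k)) /of_row enum_valK.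
have capAB : (A :&: B = 0)%MS.
  apply/eqP; rewrite -submx0; apply/rV_subP => v; rewrite sub_capmx => /andP[].
  case/submxP => w -> /sub_rVP[l wA].
  suff -> : w *m A = 0 by exact: sub0mx.
  rewrite wA; suff -> : l = 0 by rewrite scale0r.
  rewrite -(piA w); apply/esym; rewrite -[RHS]mul1r -pi1 mulr_suml.
  apply: eq_bigr => i _; move/rowP: wA => /(_ (enum_rank i)).
  by rewrite mulA enum_rankK => ->; rewrite !mxE mulr1.
have full : (1%:M <= A + B)%MS.
  rewrite sub1mx /row_full eqn_leq rank_leq_col/=.
  have := mxrank_sum_cap A B; rewrite capAB mxrank0 addn0 => ->.
  have := mxrankS kerA; rewrite mxrank_ker leq_subLR addnC.
  by [].
have /(fun H => submx_trans H full)/sub_addsmxP[[u w]/= cE] :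
  ((\row_k c (enum_val k) : 'rV[R]_n) <= 1%:M)%MS by exact: submx1.
exists (of_row (- u)) => i.
have E k : c k = \sum_j q k j * of_row u j - of_row u k + w 0 0.
  move/rowP: cE => /(_ (enum_rank k)); rewrite mxE enum_rankK => ->.
  by rewrite mxE mulA enum_rankK; congr (_ + _); rewrite mxE big_ord1 mxE mulr1.
have -> : \sum_k pi k * c k = w 0 0.
  under eq_bigr do rewrite E mulrDr.
  by rewrite big_split/= piA add0r -mulr_suml pi1 mul1r.
rewrite E /of_row; under eq_bigr do rewrite mxE mulrN.
by rewrite sumrN mxE; ring.
Qed.

End poisson.

(** * Taylor bounds for real powers *)

Section taylor.
Context {R : realType}.
Implicit Types (f df : R -> R) (t C : R).

(** By the mean value theorem a bound on the derivative gains one power of t.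
    Starting from the boundedness of (1 + t) ^ a, three rounds of this give the
    Taylor bounds below. *)
Lemma MVT_norm_le f df C k : f 0 = 0 ->
  (forall t, `|t| <= 2^-1 -> is_derive t 1 f (df t)) ->
  (forall t, `|t| <= 2^-1 -> `|df t| <= C * `|t| ^+ k) ->
  forall t, `|t| <= 2^-1 -> `|f t| <= C * `|t| ^+ k.+1.
Proof.
move=> f0 fd dfC t t2.
have C0 (u : R) : `|u| <= 2^-1 -> 0 <= C * `|u| ^+ k.
  by move=> u2; exact: le_trans (normr_ge0 _) (dfC _ u2).
have main a b : a <= b -> (a = 0 /\ b = t \/ a = t /\ b = 0) ->
    `|f b - f a| <= C * `|t| ^+ k.+1.
  move=> ab abt.
  have abt' c : a <= c <= b -> `|c| <= `|t|.
    case: abt => -[ae be]; rewrite ae be => /andP[c1 c2].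
      by rewrite !ger0_norm// (le_trans c1).
    by rewrite !ler0_norm ?lerN2// (le_trans c1).
  have fd' c : a <= c <= b -> is_derive c 1 f (df c).
    by move=> /abt' ct; apply: fd; exact: le_trans t2.
  have [c cab ->] : exists2 c, c \in `[a, b]%R & f b - f a = df c * (b - a).
    apply: MVT_segment => // [c|].
      by rewrite in_itv/= => /andP[ac cb]; apply: fd'; rewrite !ltW.
    apply: derivable_within_continuous => c; rewrite in_itv/= => cab.
    exact: (@ex_derive _ _ _ _ _ _ _ (fd' c cab)).
  move: cab; rewrite in_itv/= => cab.
  have ct := abt' _ cab.
  have -> : `|df c * (b - a)| = `|df c| * `|t|.
    rewrite normrM; congr (_ * _).
    by case: abt => -[-> ->]; rewrite ?subr0// sub0r normrN.
  rewrite exprSr mulrA ler_wpM2r//.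
  apply: (le_trans (dfC _ (le_trans ct t2))).
  have [->|kn0] := eqVneq k 0%N; first by rewrite !expr0.
  have C0' : 0 <= C.
    have := C0 2^-1; rewrite ger0_norm// lexx => /(_ isT).
    by rewrite pmulr_lge0// exprn_gt0.
  by rewrite ler_wpM2l// lerXn2r// ?nnegrE.
have [t0|t0] := leP 0 t.
  by rewrite -[f t]subr0 -f0; apply: main => //; left.
by rewrite -normrN -[- f t]add0r -f0; apply: main; [exact: ltW|right].
Qed.

Let onep_gt0 t : `|t| <= 2^-1 -> 0 < 1 + t.
Proof. by rewrite ler_norml => /andP[h _]; lra. Qed.

Lemma is_derive_onep_powR a t : `|t| <= 2^-1 ->
  is_derive t 1 (fun t => (1 + t) `^ a) (a * (1 + t) `^ (a - 1)).
Proof.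
move=> /onep_gt0 t0.
have -> : (fun t => (1 + t) `^ a) = (fun u : R => u `^ a) \o (fun t : R => 1 + t).
  by [].
have H1 : is_derive t 1 (fun t : R => 1 + t) 1.
  rewrite -[X in is_derive _ _ _ X]add0r.
  exact: (is_deriveD (is_derive_cst (1 : R) t 1) (is_derive_id t 1)).
have H2 : is_derive (1 + t) 1 (fun u : R => u `^ a) (a * (1 + t) `^ (a - 1)).
  exact: is_derive1_powR.
by have := @is_derive1_comp R _ _ _ _ _ H2 H1; rewrite mulr1.
Qed.

Lemma onep_powR_bounded a :
  exists2 C, 0 <= C & forall t, `|t| <= 2^-1 -> `|(1 + t) `^ a| <= C.
Proof.
exists (2 `^ `|a|); first exact: powR_ge0.
move=> t t2; have := onep_gt0 t2 => t0.
rewrite ger0_norm ?powR_ge0//.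
move: t2; rewrite ler_norml => /andP[t2 t2'].
have [a0|a0] := leP 0 a.
  rewrite (ger0_norm a0); apply: ge0_ler_powR; rewrite ?nnegrE //; lra.
rewrite (ltr0_norm a0) -[a in X in X <= _]opprK powRN.
have <- : (2^-1 `^ (- a))^-1 = 2 `^ (- a) :> R.
  rewrite -powR_inv1 ?powR_ge0// -powRrM -(powR_inv1 (ler0n R 2)) -powRrM.
  by congr (_ `^ _); ring.
rewrite lef_pV2 ?posrE ?powR_gt0//.
apply: ge0_ler_powR; rewrite ?nnegrE//; lra.
Qed.

Lemma onep_powR_taylor0 a : exists2 C, 0 <= C & forall t, `|t| <= 2^-1 ->
  `|(1 + t) `^ a - 1| <= C * `|t|.
Proof.
have [C C0 HC] := onep_powR_bounded (a - 1).
exists (`|a| * C); first by rewrite mulr_ge0.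
move=> t t2; rewrite -[`|t| in leRHS]expr1.
apply: (@MVT_norm_le (fun t => (1 + t) `^ a - 1)
  (fun t => a * (1 + t) `^ (a - 1)) _ 0) => //.
- by rewrite addr0 powR1 subrr.
- move=> u u2; have H := is_derive_onep_powR a u2.
  by apply: is_derive_eq; rewrite subr0.
- by move=> u u2; rewrite normrM expr0 mulr1 ler_wpM2l// HC.
Qed.

Lemma onep_powR_taylor1 a : exists2 C, 0 <= C & forall t, `|t| <= 2^-1 ->
  `|(1 + t) `^ a - 1 - a * t| <= C * `|t| ^+ 2.
Proof.
have [C C0 HC] := onep_powR_taylor0 (a - 1).
exists (`|a| * C); first by rewrite mulr_ge0.
apply: (@MVT_norm_le (fun t => (1 + t) `^ a - 1 - a * t)
  (fun t => a * ((1 + t) `^ (a - 1) - 1)) _ 1) => //.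
- by rewrite addr0 powR1 mulr0 !subrr.
- move=> u u2; have H := is_derive_onep_powR a u2.
  apply: is_derive_eq; rewrite /GRing.scale/=; ring.
- by move=> u u2; rewrite normrM expr1 -mulrA ler_wpM2l// HC.
Qed.

Lemma onep_powR_taylor2 a : exists2 C, 0 <= C & forall t, `|t| <= 2^-1 ->
  `|(1 + t) `^ a - 1 - a * t - a * (a - 1) / 2 * t ^+ 2| <= C * `|t| ^+ 3.
Proof.
have [C C0 HC] := onep_powR_taylor1 (a - 1).
exists (`|a| * C); first by rewrite mulr_ge0.
apply: (@MVT_norm_le
  (fun t => (1 + t) `^ a - 1 - a * t - a * (a - 1) / 2 * t ^+ 2)
  (fun t => a * ((1 + t) `^ (a - 1) - 1 - (a - 1) * t)) _ 2) => //.
- by rewrite addr0 powR1 mulr0 expr0n/= mulr0 !subrr.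
- move=> u u2; have H := is_derive_onep_powR a u2.
  by apply: is_derive_eq; rewrite /GRing.scale/=; field.
- by move=> u u2; rewrite normrM -mulrA ler_wpM2l// HC.
Qed.

(** With r = 1 / x, the upper bound in the first case is
    y ^ nu + nu alpha y ^ (nu - 1) + beta y ^ (nu - 2) at y = x (1 + t), divided
    by x ^ nu.  For large t all the terms of the expansion are dominated by
    |t| ^ p, because p > 2, so that zero is an upper bound. *)
Lemma powR_expansion_lower (nu p alpha beta : R) : 2 < p -> p <= 3 ->
  exists2 C, 0 <= C & forall r t, 0 <= r <= 1 ->
  let main := 1 + nu * t + nu * (nu - 1) / 2 * t ^+ 2
    + nu * alpha * r * (1 + (nu - 1) * t) + beta * r ^+ 2
    - C * (`|t| `^ p + r * t ^+ 2 + r ^+ 2 * `|t|) in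
  (`|t| <= 2^-1 -> main <= (1 + t) `^ nu + nu * alpha * r * (1 + t) `^ (nu - 1)
                    + beta * r ^+ 2 * (1 + t) `^ (nu - 2)) /\
  (2^-1 < `|t| -> main <= 0).
Proof.
move=> p2 p3.
have [C1 C10 H1] := onep_powR_taylor2 nu.
have [C2 C20 H2] := onep_powR_taylor1 (nu - 1).
have [C3 C30 H3] := onep_powR_taylor0 (nu - 2).
pose C4 := 8 * (1 + `|nu| + `|nu * (nu - 1) / 2|
  + `|nu * alpha| * (1 + `|nu - 1|) + `|beta|).
have C40 : 0 <= C4 by rewrite mulr_ge0// !addr_ge0// mulr_ge0// addr_ge0.
exists (C1 + `|nu * alpha| * C2 + `|beta| * C3 + C4).
  by rewrite !addr_ge0// mulr_ge0.
move=> r t /andP[r0 r1]/=; set tp := `|t| `^ p.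
have tp0 : 0 <= tp by exact: powR_ge0.
have e2 : 0 <= r * t ^+ 2 by rewrite mulr_ge0// sqr_ge0.
have e3 : 0 <= r ^+ 2 * `|t| by rewrite mulr_ge0// sqr_ge0.
have na := normr_ge0 (nu * alpha); have nb := normr_ge0 beta.
split => t2.
  have t3p : `|t| ^+ 3 <= tp.
    rewrite /tp -powR_mulrn//; have [->|tn0] := eqVneq t 0.
      by rewrite normr0 !powR0//; lra.
    by rewrite ger_powR// normr_gt0 tn0 (le_trans t2)//; lra.
  have {}H1 : `|(1 + t) `^ nu - 1 - nu * t - nu * (nu - 1) / 2 * t ^+ 2| <= C1 * tp.
    by apply: (le_trans (H1 _ t2)); rewrite ler_wpM2l.
  have {}H2 : `|nu * alpha * r * ((1 + t) `^ (nu - 1) - 1 - (nu - 1) * t)|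
      <= `|nu * alpha| * C2 * (r * t ^+ 2).
    have -> : `|nu * alpha| * C2 * (r * t ^+ 2)
        = `|nu * alpha| * r * (C2 * t ^+ 2) by ring.
    rewrite normrM (normrM _ r) (ger0_norm r0) ler_wpM2l ?mulr_ge0//.
    by rewrite -(real_normK (num_real t)) H2.
  have {}H3 : `|beta * r ^+ 2 * ((1 + t) `^ (nu - 2) - 1)|
      <= `|beta| * C3 * (r ^+ 2 * `|t|).
    have -> : `|beta| * C3 * (r ^+ 2 * `|t|)
        = `|beta| * r ^+ 2 * (C3 * `|t|) by ring.
    rewrite normrM normrM (ger0_norm (sqr_ge0 r)) ler_wpM2l ?H3//.
    by rewrite mulr_ge0// sqr_ge0.
  move: H1 H2 H3; rewrite !ler_norml => /andP[H1 _] /andP[H2 _] /andP[H3 _].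
  have E1 : 0 <= (`|nu * alpha| * C2 + `|beta| * C3 + C4) * tp.
    by rewrite mulr_ge0// !addr_ge0// mulr_ge0.
  have E2 : 0 <= (C1 + `|beta| * C3 + C4) * (r * t ^+ 2).
    by rewrite mulr_ge0// !addr_ge0// mulr_ge0.
  have E3 : 0 <= (C1 + `|nu * alpha| * C2 + C4) * (r ^+ 2 * `|t|).
    by rewrite mulr_ge0// !addr_ge0// mulr_ge0.
  move: H1 H2 H3 E1 E2 E3.
  set u0 := (1 + t) `^ nu; set u1 := (1 + t) `^ (nu - 1).
  set u2 := (1 + t) `^ (nu - 2) => H1 H2 H3 E1 E2 E3.
  lra.
(* As 2 |t| >= 1 and k <= p <= 3,
   |t| ^ k <= (2 |t|) ^ k <= (2 |t|) ^ p <= 8 |t| ^ p. *)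
have T k : (k <= 2)%N -> `|t| ^+ k <= 8 * tp.
  move=> k2; set s := 2 * `|t|.
  have s1 : 1 <= s by rewrite /s; lra.
  have sp : s ^+ k <= 8 * tp.
    have -> : 8 = 2 `^ 3 :> R by rewrite powR_mulrn//; lra.
    apply: (@le_trans _ _ (2 `^ p * tp)); last first.
      by rewrite ler_wpM2r// ler_powR//; lra.
    rewrite /tp -powRM// -/s -powR_mulrn ?(le_trans _ s1)// ler_powR//.
    apply: (@le_trans _ _ 2); last lra.
    by rewrite (ler_nat _ k 2).
  have ts : `|t| <= s by have := normr_ge0 t; rewrite /s; lra.
  by apply: le_trans sp; rewrite lerXn2r// nnegrE (le_trans _ ts).
have T0 := T 0%N isT; have T1 := T 1%N isT; have T2 := T 2%N isT.
rewrite expr0 in T0; rewrite expr1 in T1; rewrite real_normK ?num_real// in T2.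
have A1 : nu * t <= `|nu| * (8 * tp).
  by rewrite (le_trans (ler_norm _))// normrM ler_wpM2l.
have A2 : nu * (nu - 1) / 2 * t ^+ 2 <= `|nu * (nu - 1) / 2| * (8 * tp).
  rewrite (le_trans (ler_norm _))// normrM ler_wpM2l//.
  by rewrite ger0_norm// sqr_ge0.
have A3 : nu * alpha * r * (1 + (nu - 1) * t) <=
    `|nu * alpha| * ((1 + `|nu - 1|) * (8 * tp)).
  rewrite (le_trans (ler_norm _))// 2!normrM -mulrA ler_wpM2l//.
  rewrite -[leRHS]mul1r ler_pM// ?(ger0_norm r0)//.
  rewrite (le_trans (ler_normD _ _))// normr1 [leRHS]mulrDl mul1r lerD//.
  by rewrite normrM ler_wpM2l.
have A4 : beta * r ^+ 2 <= `|beta| * (8 * tp).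
  rewrite (le_trans (ler_norm _))// normrM ler_wpM2l//.
  by rewrite (le_trans _ T0)// ger0_norm ?sqr_ge0// expr_le1.
have E1 : 0 <= (C1 + `|nu * alpha| * C2 + `|beta| * C3) * tp.
  by rewrite mulr_ge0// !addr_ge0// mulr_ge0.
have E23 : 0 <= (C1 + `|nu * alpha| * C2 + `|beta| * C3 + C4) *
    (r * t ^+ 2 + r ^+ 2 * `|t|).
  by apply: mulr_ge0; [rewrite !addr_ge0// mulr_ge0|exact: addr_ge0].
by rewrite /C4 in E23 *; lra.
Qed.

End taylor.

(** * Means under the one-step law *)

Section mean.
Context {R : realType} {d : measure_display} {T : measurableType d}.
Variable m : probability T R.
Implicit Types (f g : T -> R) (u v c : R).

(** Bundling integrability with the value of the integral turns linearity of the
    integral into rules without side conditions. *)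
Definition has_mean f v :=
  m.-integrable setT (EFin \o f) /\ \int[m]_w f w = v.

Lemma has_meanD f g u v :
  has_mean f u -> has_mean g v -> has_mean (fun w => f w + g w) (u + v).
Proof.
move=> [fi fu] [gi gv]; split; last by rewrite RintegralD// fu gv.
exact: (integrableD measurableT fi gi).
Qed.

Lemma has_meanZ c f u : has_mean f u -> has_mean (fun w => c * f w) (c * u).
Proof.
move=> [fi fu]; split; last by rewrite RintegralZl// fu.
exact: (integrableZl measurableT c fi).
Qed.

Lemma has_mean_cst c : has_mean (fun=> c) c.
Proof.
split; last by rewrite Rintegral_cst//= probability_setT mulr1.
exact: finite_measure_integrable_cst.
Qed.

Lemma has_mean_sum (I : finType) (f : I -> T -> R) (u : I -> R) :
  (forall i, has_mean (f i) (u i)) ->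
  has_mean (fun w => \sum_i f i w) (\sum_i u i).
Proof.
move=> fu; elim: (index_enum I) => [|i s IH].
  rewrite big_nil; under eq_fun do rewrite big_nil.
  exact: has_mean_cst.
rewrite big_cons; under eq_fun do rewrite big_cons.
exact: has_meanD.
Qed.

(** The pointwise bound may fail off a set of full measure, since drift estimates
    are only available at the states of the chain. *)
Lemma has_mean_le (D : set T) f v (g : T -> \bar R) : measurable D -> m D = 1%E ->
  measurable_fun setT g -> has_mean f v ->
  (forall w, (0 <= g w)%E) -> (forall w, D w -> ((f w)%:E <= g w)%E) ->
  (v%:E <= \int[m]_w g w)%E.
Proof.
move=> mD D1 mg [fi fv] g0 fg.
have [->|] := eqVneq (\int[m]_w g w)%E +oo%E; first exact: leey.
rewrite -ltey => goo.
have gi : m.-integrable setT g.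
  apply/integrableP; split => //.
  by under eq_integral => w _ do rewrite gee0_abs//.
have Dc0 : m (~` D) = 0%E by rewrite probability_setC// D1 subee.
rewrite -fv /Rintegral fineK; last exact: integrable_fin_num.
rewrite [leLHS](negligible_integral _ _ _ Dc0)//; last exact: measurableC.
rewrite [leRHS](negligible_integral _ _ _ Dc0)//; last exact: measurableC.
rewrite setTD setCK; apply: le_integral => //.
- exact: integrableS fi.
- exact: integrableS gi.
- by move=> w /set_mem; exact: fg.
Qed.

End mean.

Section strip_step.
Context {R : realType} {S : finType} {s0 : S}.
Local Notation T := (strip R s0).
Implicit Types (K : transition_law R s0) (i j : S) (x : R).

Lemma measurable_strip (d : measure_display) (U : measurableType d) (D : set T)
  (f : T -> U) : measurable_fun D f.
Proof. by []. Qed.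

Lemma has_mean_dominated (m : probability T R) (f g : T -> R) c v :
  has_mean m g v -> (forall w, `|f w| <= c * g w) ->
  exists2 u, has_mean m f u & `|u| <= c * v.
Proof.
move=> gv fg.
have [cgi cgv] := has_meanZ c gv.
have fi : m.-integrable setT (EFin \o f).
  apply: le_integrable cgi => // w _ /=.
  by rewrite lee_fin (le_trans (fg w))// ler_norm.
exists (\int[m]_w f w) => //.
rewrite -cgv (le_trans (le_normr_Rintegral _ fi))//.
apply: le_Rintegral => //.
exact: (integrable_norm fi).
Qed.

Variables (K : transition_law R s0) (p C : R) (i : S) (x : R).
Hypothesis p2 : 2 < p.
Hypothesis momp : (Eincr K i x (fun D _ => (`|D| `^ p)%R) <= C%:E)%E.

Let m := K (x, i).
Let D (w : T) := w.1 - x.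

Let mom_main : exists2 u, has_mean m (fun w => 1 + `|D w| `^ p) u & u <= 1 + C.
Proof.
have fi : m.-integrable setT (EFin \o (fun w => `|D w| `^ p)).
  apply/integrableP; split => //.
  under eq_integral do rewrite /= ger0_norm ?powR_ge0//.
  move: momp; rewrite /Eincr unlock => h.
  by rewrite (le_lt_trans h)// ltry.
exists (1 + \int[m]_w (`|D w| `^ p)).
  by apply: has_meanD; [exact: has_mean_cst|split].
rewrite lerD2l -lee_fin /Rintegral fineK; last exact: integrable_fin_num.
by move: momp; rewrite /Eincr unlock.
Qed.

Let powD_le (r : R) w : 0 <= r <= p -> `|D w| `^ r <= 1 + `|D w| `^ p.
Proof.
move=> /andP[r0 rp]; have [D1|D1] := leP `|D w| 1.
  apply: (@le_trans _ _ 1); last by rewrite lerDl powR_ge0.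
  have -> : 1 = 1 `^ r :> R by rewrite powR1.
  by rewrite ge0_ler_powR// nnegrE.
by rewrite (@le_trans _ _ (`|D w| `^ p))// ?lerDr// ler_powR// ltW.
Qed.

Lemma step_moment (r : R) : 0 <= r <= p ->
  exists2 u, has_mean m (fun w => `|D w| `^ r) u & u <= 1 + C.
Proof.
move=> rp; have [v gv vC] := mom_main.
have [|u fu uv] := @has_mean_dominated m (fun w => `|D w| `^ r) _ 1 v gv.
  by move=> w; rewrite mul1r ger0_norm ?powR_ge0// powD_le.
exists u => //; apply: le_trans vC; rewrite -[v]mul1r.
exact: le_trans (ler_norm u) uv.
Qed.

Let bnd (f : T -> R) : (forall w, `|f w| <= 1 + `|D w| `^ p) ->
  has_mean m f (\int[m]_w f w).
Proof.
move=> fb; have [v gv vC] := mom_main.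
have [|u [fi _] _] := @has_mean_dominated m f _ 1 v gv; last by split.
by move=> w; rewrite mul1r.
Qed.

Let D1_le w : `|D w| <= 1 + `|D w| `^ p.
Proof.
rewrite -[leLHS]powRr1//; apply: powD_le.
by rewrite ler01 (le_trans _ (ltW p2))// ler1n.
Qed.

Lemma has_mean_mu : has_mean m D (mu K i x).
Proof. by rewrite /mu /Eincr unlock; apply: bnd D1_le. Qed.

Lemma has_mean_sigma2 : has_mean m (fun w => D w ^+ 2) (sigma2 K i x).
Proof.
rewrite /sigma2 /Eincr unlock; apply: bnd => w.
rewrite normrX -powR_mulrn//; by apply: powD_le; rewrite ler0n ltW.
Qed.

Lemma has_mean_muj j :
  has_mean m (fun w => D w * (w.2 == j)%:R) (muj K i j x).
Proof.
rewrite /muj /Eincr unlock; apply: bnd => w.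
case: eqP => _; first by rewrite mulr1.
by rewrite mulr0 normr0 addr_ge0// powR_ge0.
Qed.

Lemma has_mean_qj j : has_mean m (fun w => (w.2 == j)%:R) (qj K i j x).
Proof.
have -> : qj K i j x = \int[m]_w (w.2 == j)%:R.
  rewrite /qj /Rintegral; congr fine.
  rewrite -[X in m X]setIT -integral_indic//; apply: eq_integral => w _.
  rewrite indicE; congr ((nat_of_bool _)%:R%:E).
  by apply/idP/idP => [/set_mem/= ->//|/eqP h]; exact/mem_set.
by apply: bnd => w; case: eqP => _; rewrite ?normr1 ?normr0 ?lerDl ?powR_ge0.
Qed.

Lemma sum_pick (A : S -> R) k : \sum_j A j * (k == j)%:R = A k.
Proof.
rewrite (bigD1 k)//= eqxx mulr1 big1 ?addr0// => j jk.
by rewrite eq_sym (negbTE jk) mulr0.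
Qed.

Lemma sum_qj : \sum_j qj K i j x = 1.
Proof.
have [_ E1] := has_mean_sum has_mean_qj.
have [_ E2] := @has_mean_cst _ _ _ m 1.
rewrite -[LHS]E1 -[RHS]E2.
congr fine; apply: eq_integral => w _; congr EFin.
have := sum_pick (fun=> 1) w.2; under eq_bigr do rewrite mul1r.
by [].
Qed.

Lemma has_mean_quadratic (A B : S -> R) b c :
  has_mean m (fun w => A w.2 + b * D w + B w.2 * D w + c * D w ^+ 2)
    (\sum_j A j * qj K i j x + b * mu K i x + \sum_j B j * muj K i j x
     + c * sigma2 K i x).
Proof.
apply: has_meanD; last exact/has_meanZ/has_mean_sigma2.
apply: has_meanD; first apply: has_meanD.
- have -> : (fun w : T => A w.2) = (fun w : T => \sum_j A j * (w.2 == j)%:R).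
    by apply/funext => w; rewrite sum_pick.
  by apply: has_mean_sum => j; exact/has_meanZ/has_mean_qj.
- exact/has_meanZ/has_mean_mu.
- have -> : (fun w : T => B w.2 * D w) =
      (fun w : T => \sum_j B j * (D w * (w.2 == j)%:R)).
    apply/funext => w; rewrite -{1}(sum_pick B w.2) mulr_suml.
    by apply: eq_bigr => j _; rewrite -mulrA (mulrC (D w)).
  by apply: has_mean_sum => j; exact/has_meanZ/has_mean_muj.
Qed.

End strip_step.

(** * Fibers over a countable set and the Markov property *)

Section fibers.
Local Open Scope ereal_scope.
Context {R : realType} {U : Type} (V : set U).
Hypothesis cV : countable V.

(** Fibers of X numbered through an injection e of V into the integers; the
    numbers that e does not use give empty fibers. *)
Let fiber (T : Type) (A : set T) (X : T -> U) (e : U -> nat) k :=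
  A `&` [set t | V (X t) /\ e (X t) = k].

Let fiberE (T : Type) (A : set T) (X : T -> U) e : {in V &, injective e} ->
  forall k, fiber A X e k = set0 \/
    exists2 v, V v /\ e v = k & fiber A X e k = A `&` X @^-1` [set v].
Proof.
move=> inje k; have [[v [Vv ev]]|nov] := pselect (exists v, V v /\ e v = k).
  right; exists v => //; apply/seteqP; split => t [At /=].
    move=> [VX eX]; split => //; apply: inje; rewrite ?inE//; last by rewrite eX.
  by move=> Xt; split => //=; rewrite Xt.
left; rewrite -subset0 => t [_ /= [VX eX]]; apply: nov.
by exists (X t).
Qed.

Let bigcup_fiber (T : Type) (A : set T) (X : T -> U) e :
  A `<=` X @^-1` V -> A = \bigcup_k fiber A X e k.
Proof.
move=> AV; apply/seteqP; split => [t At|t [k _ []]//].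
by exists (e (X t)) => //; split => //; split => //; exact: AV.
Qed.

Let fiber_measurable d (T : measurableType d) (A : set T) (X : T -> U) e k :
  {in V &, injective e} ->
  (forall v, V v -> measurable (A `&` X @^-1` [set v])) ->
  measurable (fiber A X e k).
Proof.
move=> /(fiberE A X)/(_ k)[->//|[v [Vv _] ->]] mA; exact: mA.
Qed.

Lemma measurable_fibers d (T : measurableType d) (A : set T) (X : T -> U) :
  A `<=` X @^-1` V ->
  (forall v, V v -> measurable (A `&` X @^-1` [set v])) -> measurable A.
Proof.
move=> AV mA; have [e inje] := countable_injP _ cV.
rewrite (bigcup_fiber e AV); apply: bigcupT_measurable => k.
exact: fiber_measurable.
Qed.

(** Integrals of functions of countably valued variables, possibly on two
    different spaces, can be compared fiber by fiber. *)
Lemma le_integral_fibers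
    d1 (T1 : measurableType d1) (m1 : {measure set T1 -> \bar R})
    (A1 : set T1) (X1 : T1 -> U) (f1 : T1 -> \bar R)
    d2 (T2 : measurableType d2) (m2 : {measure set T2 -> \bar R})
    (A2 : set T2) (X2 : T2 -> U) (f2 : T2 -> \bar R) :
  A1 `<=` X1 @^-1` V -> A2 `<=` X2 @^-1` V ->
  (forall v, V v -> measurable (A1 `&` X1 @^-1` [set v])) ->
  (forall v, V v -> measurable (A2 `&` X2 @^-1` [set v])) ->
  measurable_fun A1 f1 -> measurable_fun A2 f2 ->
  (forall t, A1 t -> 0 <= f1 t) -> (forall t, A2 t -> 0 <= f2 t) ->
  (forall v, V v -> \int[m1]_(t in A1 `&` X1 @^-1` [set v]) f1 t <=
                    \int[m2]_(t in A2 `&` X2 @^-1` [set v]) f2 t) ->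
  \int[m1]_(t in A1) f1 t <= \int[m2]_(t in A2) f2 t.
Proof.
move=> AV1 AV2 mA1 mA2 mf1 mf2 f10 f20 le12.
have [e inje] := countable_injP _ cV.
have tF (T : Type) (A : set T) (X : T -> U) : trivIset setT (fiber A X e).
  by move=> i j _ _ [t [[_ [_ <-]] [_ [_ <-]]]].
have D1 := bigcup_fiber e AV1; have D2 := bigcup_fiber e AV2.
rewrite D1 D2 in mf1 mf2 f10 f20 *.
rewrite !ge0_integral_bigcup//.
- apply: lee_nneseries => [k _ _|k _].
    by apply: integral_ge0 => t Ft; rewrite f10//; exists k.
  case: (fiberE A1 X1 inje k) => [->|[v [Vv ev] F1]].
    rewrite integral_set0; apply: integral_ge0 => t Ft.
    by rewrite f20//; exists k.
  case: (fiberE A2 X2 inje k) => [F2|[v' [Vv' ev'] F2]].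
    rewrite F1; apply: (le_trans (le12 _ Vv)).
    suff -> : A2 `&` X2 @^-1` [set v] = set0 by rewrite F2 !integral_set0.
    rewrite -F2; apply/seteqP; split => t [At /=].
      by move=> Xt; split => //=; rewrite Xt.
    move=> [VX eX]; split => //; apply: inje; rewrite ?inE//; last by rewrite eX.
  have vv' : v' = v by apply: inje; rewrite ?inE// ev ev'.
  by rewrite F1 F2 vv'; exact: le12.
- by move=> k; exact: fiber_measurable.
- by move=> k; exact: fiber_measurable.
Qed.

Lemma eq_integral_fibers
    d1 (T1 : measurableType d1) (m1 : {measure set T1 -> \bar R})
    (A1 : set T1) (X1 : T1 -> U) (f1 : T1 -> \bar R)
    d2 (T2 : measurableType d2) (m2 : {measure set T2 -> \bar R})
    (A2 : set T2) (X2 : T2 -> U) (f2 : T2 -> \bar R) :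
  A1 `<=` X1 @^-1` V -> A2 `<=` X2 @^-1` V ->
  (forall v, V v -> measurable (A1 `&` X1 @^-1` [set v])) ->
  (forall v, V v -> measurable (A2 `&` X2 @^-1` [set v])) ->
  measurable_fun A1 f1 -> measurable_fun A2 f2 ->
  (forall t, A1 t -> 0 <= f1 t) -> (forall t, A2 t -> 0 <= f2 t) ->
  (forall v, V v -> \int[m1]_(t in A1 `&` X1 @^-1` [set v]) f1 t =
                    \int[m2]_(t in A2 `&` X2 @^-1` [set v]) f2 t) ->
  \int[m1]_(t in A1) f1 t = \int[m2]_(t in A2) f2 t.
Proof.
move=> AV1 AV2 mA1 mA2 mf1 mf2 f10 f20 e12; apply/eqP; rewrite eq_le.
apply/andP; split.
- by apply: (@le_integral_fibers _ _ _ _ X1 _ _ _ _ _ X2) => // v /e12 ->.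
- by apply: (@le_integral_fibers _ _ _ _ X2 _ _ _ _ _ X1) => // v /e12 ->.
Qed.

End fibers.

Section markov.
Local Open Scope ereal_scope.
Context {R : realType} {S : finType} {s0 : S}.
Local Notation T := (strip R s0).

Lemma half_strip_countable (Sigma : set T) : half_strip Sigma -> countable Sigma.
Proof.
move=> HS.
have -> : Sigma = \bigcup_(n in [set: nat]) (Sigma `&` [set z | (z.1 <= n%:R)%R]).
  apply/seteqP; split => [z Sz|z [n _ []]//].
  exists (Num.truncn z.1).+1 => //; split => //=.
  exact/ltW/truncnS_gt.
apply: bigcup_countable => // n _; apply: finite_set_countable.
exact: (strip_locally_finite HS (ler0n R n)).
Qed.

Variables (Sigma : set T) (K : transition_law R s0) (z0 : T).
Variables (d : measure_display) (Omega : measurableType d).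
Variables (P : probability Omega R) (Z : nat -> {RV P >-> T}).
Hypothesis cSigma : countable Sigma.
Hypothesis lawK : law_on Sigma K.
Hypothesis chainZ : markov_chain Sigma K z0 Z.

Definition history (n : nat) (w : Omega) : seq T := mkseq (fun k => Z k w) n.+1.

(** There are countably many finite paths, which makes every event about the
    first n states measurable and reduces it to cylinders. *)
Let paths : set (seq T) := [set s : seq T | forall z : T, z \in s -> Sigma z].

Let countable_paths : countable paths.
Proof.
have [e inje] := countable_injP _ cSigma.
apply/countable_injP; exists (fun s => pickle (map e s)) => s t.
rewrite !inE => Ss St /(pcan_inj pickleK).
elim: s t Ss St => [|z s IH] [|y t]//= Ss St [ezy est].
congr (_ :: _).
  by apply: inje => //; rewrite inE; [apply: Ss|apply: St]; rewrite mem_head.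
by apply: IH => // x xs; [apply: Ss|apply: St]; rewrite inE xs orbT.
Qed.

Let history_paths n w : paths (history n w).
Proof. by move=> z /mapP[k _ ->]; exact: (chain_in chainZ). Qed.

Let measurable_Z n (B : set T) : measurable (Z n @^-1` B).
Proof. by rewrite -[X in measurable X]setTI; exact: measurable_funP. Qed.

Let history_fiber n (s : seq T) : size s = n.+1 ->
  history n @^-1` [set s] = \bigcap_(k in `I_n.+1) (Z k @^-1` [set nth z0 s k]).
Proof.
move=> sn; apply/seteqP; split => w /=.
  by move=> <- k /= kn; rewrite nth_mkseq.
move=> H; apply: (@eq_from_nth _ z0); rewrite size_mkseq// => k kn.
by rewrite nth_mkseq//; exact: H.
Qed.

Let measurable_history_fiber n s : measurable (history n @^-1` [set s]).
Proof.
have [sn|sn] := eqVneq (size s) n.+1.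
  rewrite history_fiber//; apply: bigcap_measurableType => k _.
  exact: measurable_Z.
suff -> : history n @^-1` [set s] = set0 by [].
rewrite -subset0 => w /= ws; move: sn.
by rewrite -ws size_mkseq eqxx.
Qed.

Lemma measurable_history n (Q : set (seq T)) : measurable (history n @^-1` Q).
Proof.
apply: (measurable_fibers countable_paths (X := history n)) => [w _|s _].
  exact: history_paths.
have [Qs|Qs] := pselect (Q s).
  suff -> : history n @^-1` Q `&` history n @^-1` [set s] =
      history n @^-1` [set s] by exact: measurable_history_fiber.
  by rewrite setIidr// => w /= ->.
suff -> : history n @^-1` Q `&` history n @^-1` [set s] = set0 by [].
by rewrite -subset0 => w [/= + ws]; rewrite ws.
Qed.

Lemma measurable_chain_fun d' (U : measurableType d') (D : set Omega)
  (f : T -> U) n : measurable_fun D (fun w => f (Z n w)).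
Proof.
by apply/measurable_funTS; apply: measurableT_comp => //; exact: measurable_strip.
Qed.

Let law_integral v (f : T -> \bar R) : Sigma v -> (forall w, 0 <= f w) ->
  \int[K v]_(w in Sigma) f w = \int[K v]_w f w.
Proof.
move=> Sv f0.
have N0 : K v (~` Sigma) = 0 by rewrite probability_setC// lawK// subee.
by rewrite [RHS](ge0_negligible_integral _ _ _ _ N0)// setTD setCK.
Qed.

(** One step of the chain after an event that depends on the past only.  The
    event splits into countably many cylinders, on which this is the Markov
    property summed over the next state. *)
Lemma markov_integral n (Q : set (seq T)) (f : T -> \bar R) :
  (forall w, 0 <= f w) ->
  \int[P]_(w in history n @^-1` Q) f (Z n.+1 w) =
  \int[P]_(w in history n @^-1` Q) \int[K (Z n w)]_v f v.
Proof.
move=> f0; pose Kf v := \int[K v]_w f w.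
have Kf0 v : 0 <= Kf v by exact: integral_ge0.
have mQ s : measurable (history n @^-1` Q `&` history n @^-1` [set s]).
  exact: measurableI (measurable_history _ _) (measurable_history_fiber _ _).
apply: (eq_integral_fibers countable_paths (X1 := history n) (X2 := history n)) => //.
- by move=> w _; exact: history_paths.
- by move=> w _; exact: history_paths.
- exact: measurable_chain_fun.
- exact: (measurable_chain_fun Kf n).
- by move=> w _; exact: Kf0.
move=> s Ss.
have [[Qs sn]|nQ] := pselect (Q s /\ size s = n.+1); last first.
  suff -> : history n @^-1` Q `&` history n @^-1` [set s] = set0.
    by rewrite !integral_set0.
  rewrite -subset0 => w [/= + ws]; rewrite ws => Qs; apply: nQ; split => //.
  by rewrite -ws size_mkseq.
have {mQ} -> : history n @^-1` Q `&` history n @^-1` [set s] =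
    history n @^-1` [set s] by rewrite setIidr// => w /= ->.
set cyl := history n @^-1` [set s]; pose v := nth z0 s n.
have mcyl : measurable cyl by exact: measurable_history_fiber.
have Sv : Sigma v by apply: Ss; rewrite mem_nth// sn.
have cylv w : cyl w -> Z n w = v.
  by rewrite /v => <-; rewrite nth_mkseq.
transitivity (\int[K v]_(w in Sigma) (P cyl * f w)); last first.
  rewrite ge0_integralZl// law_integral//.
  rewrite (eq_integral (cst (Kf v))); last by move=> w /set_mem/cylv ->.
  by rewrite integral_cst// muleC.
apply: (eq_integral_fibers cSigma (X1 := Z n.+1) (X2 := id)) => //.
- by move=> w _; exact: (chain_in chainZ).
- by move=> w _; apply: measurableI => //; exact: measurable_Z.
- exact: measurable_chain_fun.
- by move=> w _; exact: mule_ge0.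
move=> w Sw.
rewrite (eq_integral (cst (f w))); last by move=> t /set_mem[_ /= Xt]; rewrite /= Xt.
rewrite integral_cst; last by apply: measurableI => //; exact: measurable_Z.
rewrite [RHS](eq_integral (cst (P cyl * f w))); last first.
  by move=> t /set_mem[_ /= Xt]; rewrite /= Xt.
have Sigma_w : Sigma `&` id @^-1` [set w] = [set w].
  by rewrite setIidr// => t /= ->.
rewrite Sigma_w integral_cst//=.
rewrite [P cyl * _]muleC -muleA; congr (_ * _).
pose u k := if k == n.+1 then w else nth z0 s k.
have := chain_markov chainZ n u.
have -> : \bigcap_(k in `I_n.+1) (Z k @^-1` [set u k]) = cyl.
  rewrite /cyl history_fiber//; apply: eq_bigcapr => k /= kn.
  by rewrite /u ltn_eqF.
rewrite {2 3}/u eqxx ltn_eqF// => <-; congr (P _).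
rewrite /cyl history_fiber//; apply/seteqP; split => t.
  move=> [H1 H2] k /=; rewrite ltnS leq_eqVlt => /orP[/eqP ->|kn].
    by rewrite /u eqxx.
  by rewrite /u ltn_eqF//; exact: H1.
move=> H; split => [k /= kn|]; last by have := H n.+1 (ltnSn _); rewrite /u /= eqxx.
by have := H k (ltn_trans kn (ltnSn _)); rewrite /u/= ltn_eqF.
Qed.

End markov.

(** * A criterion for infinite passage moments *)

Section criterion.
Local Open Scope ereal_scope.
Context {R : realType} {S : finType} {s0 : S}.
Local Notation T := (strip R s0).

(** The probability that the chain started at w stays above x up to time n. *)
Fixpoint survival (K : transition_law R s0) (x : R) (n : nat) (w : T) : \bar R :=
  if (w.1 <= x)%R then 0
  else if n is m.+1 then \int[K w]_v survival K x m v else 1.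

Lemma survival_ge0 K x n w : 0 <= survival K x n w.
Proof.
elim: n w => [|n IH] w /=; case: ifP => // _.
by apply: integral_ge0 => v _; exact: IH.
Qed.

Lemma survival_below K x n w : (w.1 <= x)%R -> survival K x n w = 0.
Proof. by case: n => [|n] /= ->. Qed.

Lemma survival0 K x w : (x < w.1)%R -> survival K x 0 w = 1.
Proof. by move=> xw; rewrite /= leNgt xw. Qed.

Lemma survivalS K x n w : (x < w.1)%R ->
  survival K x n.+1 w = \int[K w]_v survival K x n v.
Proof. by move=> xw; rewrite /= leNgt xw. Qed.

Variables (Sigma : set T) (K : transition_law R s0) (z0 : T).
Variables (d : measure_display) (Omega : measurableType d).
Variables (P : probability Omega R) (Z : nat -> {RV P >-> T}).
Hypothesis cSigma : countable Sigma.
Hypothesis lawK : law_on Sigma K.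
Hypothesis chainZ : markov_chain Sigma K z0 Z.
Variable x : R.

(** The sigma-algebra of the first n + 1 states. *)
Let past n (E : set Omega) := exists Q, E = history Z n @^-1` Q.

Let past_measurable n E : past n E -> measurable E.
Proof. by move=> [Q ->]; exact: (measurable_history cSigma chainZ). Qed.

Let past_markov n E (f : T -> \bar R) : past n E -> (forall w, 0 <= f w) ->
  \int[P]_(w in E) f (Z n.+1 w) = \int[P]_(w in E) \int[K (Z n w)]_v f v.
Proof. by move=> [Q ->]; exact: (markov_integral cSigma lawK chainZ). Qed.

Let pastI n E F : past n E -> past n F -> past n (E `&` F).
Proof. by move=> [Q ->] [Q' ->]; exists (Q `&` Q'). Qed.

Let past_state n k (B : set T) : (k <= n)%N -> past n (Z k @^-1` B).
Proof.
move=> kn; exists [set s | B (nth z0 s k)]; apply/seteqP; split => w /=;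
by rewrite nth_mkseq.
Qed.

Let pastS n E : past n E -> past n.+1 E.
Proof.
move=> [Q ->]; exists [set s | Q (take n.+1 s)].
have H w : take n.+1 (history Z n.+1 w) = history Z n w.
  by rewrite /history /mkseq -map_take take_iota (minn_idPl (leqnSn _)).
by apply/funext => w; rewrite /preimage /mkset H.
Qed.

(** This is the event tau_x > n. *)
Definition above_until n : set Omega :=
  [set w | forall k, (k <= n)%N -> (x < (Z k w).1)%R].

Let above := [set z : T | (x < z.1)%R].

Let above_untilS n : above_until n.+1 = above_until n `&` Z n.+1 @^-1` above.
Proof.
apply/seteqP; split => w /= H.
  by split => [k kn|]; apply: H => //; exact: leqW.
by move=> k; rewrite leq_eqVlt => /orP[/eqP ->|]; [exact: H.2|exact: H.1].
Qed.

Let past_above_until n : past n (above_until n).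
Proof.
elim: n => [|n IH]; last first.
  by rewrite above_untilS; apply: pastI (pastS IH) (past_state _ _).
have -> : above_until 0 = Z 0%N @^-1` above.
  by apply/seteqP; split => w /= H; [exact: H|move=> k; rewrite leqn0 => /eqP ->].
exact: past_state.
Qed.

(** The Markov property iterated: given the past up to time n, staying above x
    for k more steps has conditional probability survival k at the state Z_n. *)
Lemma integral_survival n k E : past n E -> E `<=` Z n @^-1` above ->
  P (E `&` [set w | forall j, (j < k)%N -> (x < (Z (n + j.+1) w).1)%R]) =
  \int[P]_(w in E) survival K x k (Z n w).
Proof.
elim: k n E => [|k IH] n E pE Ex.
  rewrite (eq_integral (cst 1)); last by move=> w /set_mem/Ex; exact: survival0.
  rewrite integral_cst ?mul1e; last exact: past_measurable pE.
  by congr (P _); rewrite setIidl.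
pose E' := E `&` Z n.+1 @^-1` above.
have pE' : past n.+1 E' by apply: pastI (pastS pE) (past_state _ _).
transitivity (P (E' `&` [set w | forall j, (j < k)%N -> (x < (Z (n.+1 + j.+1) w).1)%R])).
  congr (P _); apply/seteqP; split => w /= [Ew H].
    split; first by split => //; have := H 0%N isT; rewrite addn1.
    by move=> j jk; rewrite addSnnS; exact: H.
  case: Ew => Ew Zw; split => // -[_|j jk]; first by rewrite addn1.
  by rewrite -addSnnS; exact: H.
rewrite IH//; last by move=> w [].
transitivity (\int[P]_(w in E) survival K x k (Z n.+1 w)).
  rewrite integral_mkcond [RHS]integral_mkcond; apply: eq_integral => w _.
  rewrite /patch /E' in_setI; case: ifPn => [/andP[-> _]//|].
  case: ifPn => //= wE /negP h.
  apply/esym/survival_below; rewrite leNgt; apply/negP => zx; apply: h.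
  exact/mem_set.
rewrite (past_markov pE)//; last by move=> w; exact: survival_ge0.
by apply: eq_integral => w /set_mem/Ex zx; rewrite survivalS.
Qed.

Let tauZ w := tau (fun n => (Z n w).1) x.

Let tau_ge n w : above_until n w -> (n.+1%:R)%:E <= tauZ w.
Proof.
move=> H; apply/ereal_infP => _ [k /= Zk <-].
rewrite lee_fin ler_nat ltnNge; apply/negP => /H.
by rewrite ltNge Zk.
Qed.

Let tau_oo w : (forall n, above_until n w) -> tauZ w = +oo.
Proof.
move=> H; apply/eqP; rewrite -leye_eq; apply/ereal_infP => _ [k /= Zk <-].
by have := H k k (leqnn k); rewrite ltNge Zk.
Qed.

Let tau_ge0 w : 0 <= tauZ w.
Proof. by apply/ereal_infP => _ [k /= _ <-]; rewrite lee_fin. Qed.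

Let measurable_tau : measurable_fun [set: Omega] tauZ.
Proof.
pose u w n := if ((Z n w).1 <= x)%R then (n%:R)%:E else +oo : \bar R.
have -> : tauZ = fun w => einfs (u w) 0%N.
  apply/funext => w; apply/eqP; rewrite eq_le; apply/andP; split.
    apply/ereal_infP => _ [k _ <-]; rewrite /u; case: ifPn => [Zk|_].
      by apply: ereal_inf_lbound; exists k.
    exact: leey.
  apply/ereal_infP => _ [k /= Zk <-]; apply: ereal_inf_lbound.
  by exists k => //; rewrite /u Zk.
apply: (@measurable_fun_einfs _ _ _ setT (fun n w => u w n)) => n.
exact: (measurable_chain_fun Z
  (fun z : T => if (z.1 <= x)%R then (n%:R)%:E else +oo : \bar R) n).
Qed.

Variables (s C : R) (g : T -> R).
Hypothesis s_gt0 : (0 < s)%R.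
Hypothesis C_gt0 : (0 < C)%R.
Hypothesis g_ge0 : forall w, (0 <= g w)%R.
Hypothesis g_below : forall w, (w.1 <= x)%R -> g w = 0%R.
Hypothesis g_sub : forall w, Sigma w -> (x < w.1)%R ->
  (g w)%:E <= \int[K w]_v (g v)%:E.
Hypothesis g_time : forall w, Sigma w -> (x < w.1)%R ->
  exists N : nat, (g w <= C * N.+1%:R `^ s)%R /\ (2^-1)%:E <= survival K x N w.
Hypothesis g_start : (0 < g z0)%R.

Let measurable_above n : measurable (above_until n).
Proof. exact: past_measurable (past_above_until n). Qed.

Let taus w := tauZ w `^ s.

Let measurable_taus D : measurable_fun D taus.
Proof.
apply: measurable_funTS.
exact: (measurableT_comp (measurable_poweR s) measurable_tau).
Qed.

Let taus_ge0 w : 0 <= taus w. Proof. exact: poweR_ge0. Qed.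

Let taus_ge n w : above_until n w -> (n.+1%:R `^ s)%:E <= taus w.
Proof.
move=> /tau_ge nt; rewrite -poweR_EFin; apply: gt0_ler_poweR => //; first exact: ltW.
- by rewrite in_itv/= leey lee_fin ler0n.
- by rewrite in_itv/= leey tau_ge0.
Qed.

(** Optional stopping: g does not decrease on average before the passage, and
    vanishes after it. *)
Let g_alive n : (g z0)%:E <= \int[P]_(w in above_until n) (g (Z n w))%:E.
Proof.
have mg D k : measurable_fun D (fun w => (g (Z k w))%:E).
  exact: (measurable_chain_fun Z (fun z : T => (g z)%:E) k).
elim: n => [|n IH].
  have xz0 : (x < z0.1)%R.
    by rewrite ltNge; apply/negP => /g_below gz0; move: g_start; rewrite gz0 ltxx.
  have mE : measurable (Z 0%N @^-1` [set z0]).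
    exact: past_measurable (past_state _ (leqnn 0)).
  rewrite -[leLHS]mule1 -(chain_start chainZ) -integral_cst//.
  rewrite (eq_integral (fun w => (g (Z 0%N w))%:E)); last first.
    by move=> w /set_mem /= ->.
  apply: ge0_subset_integral => //.
  - by move=> w _; rewrite lee_fin.
  - by move=> w /= Zw k; rewrite leqn0 => /eqP ->; rewrite Zw.
apply: (le_trans IH).
apply: (@le_trans _ _ (\int[P]_(w in above_until n) \int[K (Z n w)]_v (g v)%:E)).
  apply: ge0_le_integral => //.
  - by move=> w _; rewrite lee_fin.
  - exact: (measurable_chain_fun Z (fun z => \int[K z]_v (g v)%:E) n).
  - move=> w Aw; apply: g_sub; first exact: (chain_in chainZ).
    exact: Aw.
rewrite -(past_markov (past_above_until n) (f := fun z => (g z)%:E)); last first.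
  by move=> w; rewrite lee_fin.
rewrite le_eqVlt; apply/orP; left; apply/eqP.
rewrite integral_mkcond [RHS]integral_mkcond; apply: eq_integral => w _.
rewrite /patch above_untilS in_setI; case: ifPn => //= wA.
case: ifPn => // /negP h; congr EFin; apply: g_below.
by rewrite leNgt; apply/negP => zx; apply: h; exact/mem_set.
Qed.

(** From a state w at time n the chain survives about N more steps with
    probability at least one half, where g w is of order N `^ s. *)
Let g_le_taus n : \int[P]_(w in above_until n) (g (Z n w))%:E <=
  (2 * C)%:E * \int[P]_(w in above_until n) taus w.
Proof.
rewrite -ge0_integralZl//; last by rewrite lee_fin mulr_ge0// ltW.
have mF v : measurable (above_until n `&` Z n @^-1` [set v]).
  exact: past_measurable (pastI (past_above_until n) (past_state _ (leqnn n))).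
apply: (le_integral_fibers cSigma (X1 := Z n) (X2 := Z n)) => //.
- by move=> w _; exact: (chain_in chainZ).
- by move=> w _; exact: (chain_in chainZ).
- exact: (measurable_chain_fun Z (fun z : T => (g z)%:E) n).
- by apply: emeasurable_funM => //; exact: measurable_cst.
- by move=> w _; rewrite lee_fin.
- by move=> w _; rewrite mule_ge0// lee_fin mulr_ge0// ltW.
move=> v Sv; set F := above_until n `&` _.
have [vx|xv] := leP v.1 x.
  suff -> : F = set0 by rewrite !integral_set0.
  rewrite -subset0 => w [/(_ n (leqnn n)) + /= Zv].
  by rewrite Zv ltNge vx.
have mFv : measurable F := mF v.
have [N [gN survN]] := g_time Sv xv.
pose G := F `&` [set w | forall j, (j < N)%N -> (x < (Z (n + j.+1) w).1)%R].
have pF : past n F by exact: (pastI (past_above_until n) (past_state _ (leqnn n))).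
have PG : (2^-1)%:E * P F <= P G.
  rewrite (integral_survival N pF); last by move=> w [+ _]; exact.
  rewrite -integral_cst//; apply: ge0_le_integral => //.
  - by move=> w _; rewrite lee_fin.
  - exact: (measurable_chain_fun Z (survival K x N) n).
  - by move=> w [_ /= ->].
have Gab w : G w -> above_until (n + N) w.
  move=> [[Aw _] H] k; have [kn _|nk kN] := leqP k n.
    exact: Aw.
  have <- : (n + (k - n.+1).+1)%N = k by rewrite addnS -addSn subnKC.
  by apply: H; rewrite -(ltn_add2l n.+1) subnKC// addSn ltnS.
have mG : measurable G.
  have -> : G = F `&` above_until (n + N).
    apply/seteqP; split => [w Gw|w [Fw H]].
      by split; [case: Gw|exact: Gab].
    by split => // j jN; apply: H; rewrite leq_add2l.
  exact: measurableI (mF v) (measurable_above _).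
rewrite (eq_integral (cst (g v)%:E)); last by move=> w /set_mem[_ /= ->].
rewrite integral_cst// ge0_integralZl//; last by rewrite lee_fin mulr_ge0// ltW.
have NG : (N.+1%:R `^ s)%:E * P G <= \int[P]_(w in F) taus w.
  apply: (@le_trans _ _ (\int[P]_(w in G) taus w)); last first.
    by apply: ge0_subset_integral => // w [].
  rewrite -integral_cst//; apply: ge0_le_integral => //.
  - by move=> w _; rewrite lee_fin powR_ge0.
  - move=> w /Gab/taus_ge; apply: le_trans.
    rewrite lee_fin; apply: ge0_ler_powR; rewrite ?nnegrE ?ler0n//.
      exact: ltW.
    by rewrite ler_nat ltnS leq_addl.
apply: (@le_trans _ _ ((C * N.+1%:R `^ s)%:E * P F)).
  by rewrite lee_wpmul2r// lee_fin.
apply: (@le_trans _ _ ((2 * C)%:E * ((N.+1%:R `^ s)%:E * P G))); last first.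
  by rewrite lee_wpmul2l// lee_fin mulr_ge0// ltW.
apply: (@le_trans _ _ ((2 * C)%:E * ((N.+1%:R `^ s)%:E * ((2^-1)%:E * P F)))).
  rewrite !muleA -!EFinM lee_wpmul2r// lee_fin.
  by rewrite le_eqVlt; apply/orP; left; apply/eqP; field.
apply: lee_wpmul2l; first by rewrite lee_fin mulr_ge0// ltW.
by apply: lee_wpmul2l; first by rewrite lee_fin powR_ge0.
Qed.

(** If the moment were finite, its part carried by the paths that are still
    above x would tend to zero, whereas it bounds g z0. *)
Lemma passage_moment_infinite : \int[P]_w (tauZ w `^ s) = +oo.
Proof.
apply/eqP; apply: contraPT (g_start) => I_fin; apply/negP; rewrite -leNgt.
have {}I_fin : \int[P]_w taus w < +oo by rewrite ltey.
set I := \int[P]_w taus w in I_fin.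
have I_fn : I \is a fin_num.
  by rewrite ge0_fin_numE//; apply: integral_ge0.
pose c := (g z0 / (2 * C))%R.
pose B n := ~` above_until n.
have mB n : measurable (B n) by exact: measurableC.
have splitI (D : set Omega) : measurable D ->
    I = \int[P]_(w in D) taus w + \int[P]_(w in ~` D) taus w.
  move=> mD; rewrite -ge0_integral_setU//; last 2 first.
  - exact: measurableC.
  - by rewrite disj_set2E setICr.
  by rewrite setUv.
(* c bounds from below the part of the moment carried by the paths that are
   above x until time n, whatever n is. *)
have Bc n : \int[P]_(w in B n) taus w <= I - c%:E.
  have cI : c%:E <= \int[P]_(w in above_until n) taus w.
    rewrite /c EFinM muleC lee_pdivrMl; last by rewrite mulr_gt0.
    exact: le_trans (g_alive n) (g_le_taus n).
  by rewrite leeBrDl// (splitI _ (measurable_above n)) leeD2r.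
pose B' := \bigcup_n B n.
have mB' : measurable B' by exact: bigcupT_measurable.
have ndB : nondecreasing_seq B.
  move=> m n mn; rewrite subsetEset; apply: subsetC => w H k km.
  by apply: H; exact: leq_trans mn.
have cvB := ge0_nondecreasing_set_cvg_integral (mu := P) ndB mB
  (fun i => measurable_taus (D := B i)) (fun _ w _ => taus_ge0 w).
have IB' : \int[P]_(w in B') taus w <= I - c%:E.
  by apply: (cvge_le _ cvB); exact: nearW.
(* The paths that never pass below x either make the moment infinite or have
   probability zero. *)
have tauC w : (~` B') w -> taus w = +oo.
  move=> nB; rewrite /taus tau_oo ?poweRyr ?gt_eqF// => n.
  by apply: contrapT => nA; apply: nB; exists n.
have IC : \int[P]_(w in ~` B') taus w = +oo * P (~` B').
  rewrite (eq_integral (cst +oo)); last by move=> w /set_mem/tauC.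
  by rewrite integral_cst//; exact: measurableC.
have PC0 : P (~` B') = 0.
  apply/eqP; apply: contraPT I_fin => PC; rewrite (splitI _ mB') IC.
  rewrite gt0_mulye; last by rewrite lt0e PC/=.
  rewrite addey ?ltxx// -ltNye; apply: (@lt_le_trans _ _ 0); first exact: ltNy0.
  exact: integral_ge0.
move: IB'; have -> : \int[P]_(w in B') taus w = I.
  by rewrite (splitI _ mB') IC PC0 mule0 adde0.
rewrite leeBrDl// -[leRHS]add0e leeD2rE// lee_fin /c.
by rewrite pmulr_lle0// invr_gt0 mulr_gt0.
Qed.

End criterion.

(** * Asymptotics along a line *)

Section asymptotics.
Context {R : realType} {S : finType} {s0 : S}.
Variable Sigma : set (strip R s0).
Implicit Types (i : S) (f : R -> R) (c g l : R).

#[local] Instance line_infty_is_filter i : Filter (line_infty Sigma i).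
Proof. exact: within_filter. Qed.

Lemma line_infty_ge i c : \forall x \near line_infty Sigma i, c <= x.
Proof. by exists c; split; [exact: num_real|move=> x /ltW]. Qed.

Lemma near_lines (Q : S -> R -> Prop) :
  (forall i, \forall x \near line_infty Sigma i, Q i x) ->
  exists2 M, 1 <= M & forall i x, M <= x -> Sigma (x, i) -> Q i x.
Proof.
move=> HQ; have /choice[M HM] : forall i, exists M : R,
    forall x, M < x -> Sigma (x, i) -> Q i x.
  by move=> i; have [M [_ HM]] := HQ i; exists M.
exists (1 + \sum_i `|M i|); first by rewrite lerDl sumr_ge0.
move=> i x Mx; apply: HM; apply: (@lt_le_trans _ _ (1 + \sum_i `|M i|)) => //.
rewrite (bigD1 i)//= addrCA (le_lt_trans (ler_norm (M i)))// ltrDl.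
by rewrite (@lt_le_trans _ _ 1)// lerDl sumr_ge0.
Qed.

Lemma cvg_line_sum i (I : finType) (f : I -> R -> R) (l : I -> R) :
  (forall j, f j x @[x --> line_infty Sigma i] --> l j) ->
  \sum_j f j x @[x --> line_infty Sigma i] --> \sum_j l j.
Proof.
move=> fl; elim: (index_enum I) => [|j s IH].
  by rewrite big_nil; under eq_fun do rewrite big_nil; exact: cvg_cst.
rewrite big_cons; under eq_fun do rewrite big_cons.
exact: cvgD (fl j) IH.
Qed.

Lemma cvg_powR_line i (r : R) : 0 < r ->
  x `^ (- r) @[x --> line_infty Sigma i] --> 0.
Proof.
move=> r0; apply/cvgrPdist_le => e e0.
have L0 : 0 < e `^ (- r^-1) by rewrite powR_gt0.
apply: filterS (line_infty_ge i (e `^ (- r^-1))) => x ex.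
have x0 : 0 < x by exact: lt_le_trans ex.
rewrite sub0r normrN ger0_norm ?powR_ge0// powRN invf_ple ?posrE ?powR_gt0//.
have -> : e^-1 = (e `^ (- r^-1)) `^ r.
  by rewrite -powRrM mulNr mulVf ?gt_eqF// powR_inv1// ltW.
by apply: ge0_ler_powR; rewrite ?nnegrE ?(ltW L0) ?(ltW x0) ?(ltW r0).
Qed.

Lemma cvg_inv_line i : x^-1 @[x --> line_infty Sigma i] --> (0 : R).
Proof.
apply: cvg_trans (@cvg_powR_line i 1 ltr01); apply: near_eq_cvg.
apply: filterS (line_infty_ge i 0) => x x0.
by rewrite powR_inv1.
Qed.

Lemma littleo_cst_cvg i f c :
  f = (fun=> c) +o_ (line_infty Sigma i) (fun=> 1 : R) ->
  f x @[x --> line_infty Sigma i] --> c.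
Proof.
move=> /eqaddoP h; apply/cvgrPdist_le => e /h.
by apply: filterS => x; rewrite normr1 mulr1 -[(f - _) x]/(f x - c) distrC.
Qed.

Lemma littleo_inv_cvg i f c g :
  f = (fun x => c + g / x) +o_ (line_infty Sigma i) (fun x => x^-1) ->
  x * (f x - c) @[x --> line_infty Sigma i] --> g.
Proof.
move=> /eqaddoP h; apply/cvgrPdist_le => e /h {}h.
near=> x.
have x0 : 0 < x.
  by apply: (@lt_le_trans _ _ 1) => //; near: x; exact: line_infty_ge.
have : `|f x - (c + g / x)| <= e * `|x^-1| by near: x.
rewrite normfV ler_pdivlMr ?normr_gt0 ?gt_eqF// => H.
have -> : g - x * (f x - c) = - (x * (f x - (c + g / x))).
  by field; rewrite gt_eqF.
by rewrite normrN normrM mulrC.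
Unshelve. all: by end_near. Qed.

Lemma littleo_inv_cvg_cst i f c g :
  f = (fun x => c + g / x) +o_ (line_infty Sigma i) (fun x => x^-1) ->
  f x @[x --> line_infty Sigma i] --> c.
Proof.
move=> /littleo_inv_cvg h.
have : c + x^-1 * (x * (f x - c)) @[x --> line_infty Sigma i] --> c + 0 * g.
  by apply: cvgD; [exact: cvg_cst|apply: cvgM; [exact: cvg_inv_line|]].
rewrite mul0r addr0; apply: cvg_trans; apply: near_eq_cvg.
apply: filterS (line_infty_ge i 1) => x x1.
rewrite mulrA mulVf ?mul1r ?subrKC// gt_eqF//.
exact: lt_le_trans x1.
Qed.

End asymptotics.

(** * The Lyapunov function *)

Section lyapunov_function.
Context {R : realType} {S : finType} {s0 : S}.
Local Notation T := (strip R s0).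
Implicit Types (w : T) (x nu : R) (a b : S -> R).

(** The correction a removes the constant part of the drift of each line, and b
    averages the second order terms over the lines.  Cutting off at zero makes
    long downward jumps harmless in lower bounds of the drift. *)
Definition lyapunov nu a b w : R :=
  if w.1 < 1 then 0 else
  Num.max 0 (w.1 `^ nu + nu * a w.2 * w.1 `^ (nu - 1) + b w.2 * w.1 `^ (nu - 2)).

Lemma lyapunov_ge0 nu a b w : 0 <= lyapunov nu a b w.
Proof. by rewrite /lyapunov; case: ifP => // _; rewrite le_max lexx. Qed.

Lemma powR_factor x nu : 0 < x ->
  x `^ (nu - 1) = x `^ nu * x^-1 /\ x `^ (nu - 2) = x `^ nu * x^-1 ^+ 2.
Proof.
move=> x0; have xn0 : x != 0 by rewrite gt_eqF.
rewrite !powRD ?xn0 ?implybT// powR_inv1 ?(ltW x0)//; split => //.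
by rewrite powR_invn ?(ltW x0)// exprVn.
Qed.

Let absum (f : S -> R) j : f j <= \sum_i `|f i|.
Proof.
by rewrite (bigD1 j)//= (le_trans (ler_norm _))// lerDl sumr_ge0.
Qed.

Lemma lyapunov_upper nu a b : 0 < nu -> exists2 C, 0 < C &
  forall c w, 1 <= c -> w.1 <= c -> lyapunov nu a b w <= C * c `^ nu.
Proof.
move=> nu0; pose A := \sum_i `|nu * a i|; pose B := \sum_i `|b i|.
have A0 : 0 <= A by exact: sumr_ge0.
have B0 : 0 <= B by exact: sumr_ge0.
exists (1 + A + B); first lra.
move=> c w c1 wc.
have C0 : 0 <= (1 + A + B) * c `^ nu by rewrite mulr_ge0 ?powR_ge0//; lra.
rewrite /lyapunov; case: ltP => // w1.
rewrite ge_max C0/=.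
have w0 : 0 < w.1 by exact: lt_le_trans w1.
have [-> ->] := powR_factor nu w0.
have r01 : 0 <= w.1^-1 <= 1 by rewrite invr_ge0 (ltW w0)/= invf_le1.
apply: (@le_trans _ _ (w.1 `^ nu * (1 + A + B))); last first.
  rewrite mulrC ler_wpM2l//; first lra.
  by apply: ge0_ler_powR; rewrite ?nnegrE ?(ltW nu0) ?(ltW w0)// (le_trans ler01).
have -> : w.1 `^ nu + nu * a w.2 * (w.1 `^ nu * w.1^-1)
    + b w.2 * (w.1 `^ nu * w.1^-1 ^+ 2)
  = w.1 `^ nu * (1 + nu * a w.2 * w.1^-1 + b w.2 * w.1^-1 ^+ 2) by ring.
rewrite ler_wpM2l ?powR_ge0//.
have hA := absum (fun i => nu * a i) w.2; have hB := absum b w.2.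
move/andP: r01; set r := w.1^-1 => -[r0 r1].
have r21 : r ^+ 2 <= 1 by rewrite expr_le1.
have r20 : 0 <= r ^+ 2 by rewrite sqr_ge0.
rewrite -!addrA lerD2l lerD//.
- apply: (@le_trans _ _ (A * r)); first by rewrite ler_wpM2r.
  by rewrite ler_piMr.
- apply: (@le_trans _ _ (B * r ^+ 2)); first by rewrite ler_wpM2r.
  by rewrite ler_piMr.
Qed.

(** The quadratic expansion bounds the function from below for every size of the
    jump w.1 - x: for a jump longer than half of x the error term outweighs the
    rest, and the bound is at most zero. *)
Lemma lyapunov_expansion nu p a b : 2 < p -> p <= 3 ->
  exists2 C, 0 <= C & forall x w, 2 <= x ->
  let t := x^-1 * (w.1 - x) in let r := x^-1 in
  x `^ nu * (1 + nu * t + nu * (nu - 1) / 2 * t ^+ 2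
    + nu * a w.2 * r * (1 + (nu - 1) * t) + b w.2 * r ^+ 2
    - C * (`|t| `^ p + r * t ^+ 2 + r ^+ 2 * `|t|)) <= lyapunov nu a b w.
Proof.
move=> p2 p3.
have /choice[C HC] : forall j, exists C, 0 <= C /\ forall r t, 0 <= r <= 1 ->
  let main := 1 + nu * t + nu * (nu - 1) / 2 * t ^+ 2
    + nu * a j * r * (1 + (nu - 1) * t) + b j * r ^+ 2
    - C * (`|t| `^ p + r * t ^+ 2 + r ^+ 2 * `|t|) in
  (`|t| <= 2^-1 -> main <= (1 + t) `^ nu + nu * a j * r * (1 + t) `^ (nu - 1)
                    + b j * r ^+ 2 * (1 + t) `^ (nu - 2)) /\
  (2^-1 < `|t| -> main <= 0).
  by move=> j; have [C C0 HC] := powR_expansion_lower nu (a j) (b j) p2 p3; exists C.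
exists (\sum_j C j); first by apply: sumr_ge0 => j _; case: (HC j).
move=> x w x2 /=; pose r := x^-1; pose t := r * (w.1 - x).
rewrite -/r -/t.
have x0 : 0 < x by lra.
have r01 : 0 <= r <= 1 by rewrite /r invr_ge0 (ltW x0)/= invf_le1//; lra.
have [C0 /(_ r t r01)[H1 H2]] := HC w.2.
have CC : C w.2 <= \sum_j C j.
  by rewrite (bigD1 w.2)//= lerDl sumr_ge0// => j _; case: (HC j).
have E0 : 0 <= `|t| `^ p + r * t ^+ 2 + r ^+ 2 * `|t|.
  case/andP: r01 => r0 _.
  by rewrite !addr_ge0 ?powR_ge0// mulr_ge0// sqr_ge0.
apply: (@le_trans _ _ (x `^ nu * (1 + nu * t + nu * (nu - 1) / 2 * t ^+ 2
    + nu * a w.2 * r * (1 + (nu - 1) * t) + b w.2 * r ^+ 2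
    - C w.2 * (`|t| `^ p + r * t ^+ 2 + r ^+ 2 * `|t|)))).
  by rewrite ler_wpM2l ?powR_ge0// lerD2l lerN2 ler_wpM2r.
have [t2|t2] := leP `|t| 2^-1; last first.
  apply: le_trans (lyapunov_ge0 nu a b w).
  by rewrite pmulr_rle0 ?powR_gt0// H2.
apply: (le_trans (ler_wpM2l (powR_ge0 x nu) (H1 t2))).
have wx : w.1 = x * (1 + t) by rewrite /t /r; field; rewrite gt_eqF.
have t1 : 2^-1 <= 1 + t by move: t2; rewrite ler_norml => /andP[]; lra.
have t0 : 0 < 1 + t by lra.
have w1 : 1 <= w.1.
  rewrite wx; apply: (@le_trans _ _ (2 * 2^-1)); first lra.
  by rewrite ler_pM//; lra.
rewrite /lyapunov ltNge w1/= le_max; apply/orP; right.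
have [_ _] := powR_factor nu x0.
rewrite le_eqVlt; apply/orP; left; apply/eqP.
rewrite wx !powRM ?(ltW x0) ?(ltW t0)//.
have [-> ->] := powR_factor nu x0.
by rewrite -/r; ring.
Qed.

Lemma lyapunov_lower nu a b : exists2 M, 1 <= M &
  forall w, M <= w.1 ->
  w.1 `^ nu / 2 <= lyapunov nu a b w /\
  lyapunov nu a b w = w.1 `^ nu * (1 + nu * a w.2 * w.1^-1 + b w.2 * w.1^-1 ^+ 2).
Proof.
pose A := \sum_i `|- (nu * a i)|; pose B := \sum_i `|- b i|.
have A0 : 0 <= A by exact: sumr_ge0.
have B0 : 0 <= B by exact: sumr_ge0.
exists (1 + 2 * (A + B)); first lra.
move=> w Mw; have w1 : 1 <= w.1 by lra.
have w0 : 0 < w.1 by exact: lt_le_trans w1.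
rewrite /lyapunov ltNge w1/=.
have [-> ->] := powR_factor nu w0.
have -> : w.1 `^ nu + nu * a w.2 * (w.1 `^ nu * w.1^-1)
    + b w.2 * (w.1 `^ nu * w.1^-1 ^+ 2)
  = w.1 `^ nu * (1 + nu * a w.2 * w.1^-1 + b w.2 * w.1^-1 ^+ 2) by ring.
suff H : 2^-1 <= 1 + nu * a w.2 * w.1^-1 + b w.2 * w.1^-1 ^+ 2.
  rewrite max_r; last by rewrite mulr_ge0 ?powR_ge0//; lra.
  by rewrite ler_wpM2l ?powR_ge0.
have hA := absum (fun i => - (nu * a i)) w.2; have hB := absum (fun i => - b i) w.2.
rewrite -/A -/B /= in hA hB.
have r1 : w.1^-1 <= 1 by rewrite invf_le1.
have rAB : (A + B) * w.1^-1 <= 2^-1 by rewrite ler_pdivrMr//; lra.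
have r0 : 0 <= w.1^-1 by rewrite invr_ge0 ltW.
move: r0 r1 rAB; set r := w.1^-1 => r0 r1 rAB.
have h1 : - (nu * a w.2) * r <= A * r by rewrite ler_wpM2r.
have h2 : - b w.2 * r ^+ 2 <= B * r.
  apply: (@le_trans _ _ (B * r ^+ 2)); first by rewrite ler_wpM2r// sqr_ge0.
  by rewrite ler_wpM2l// expr2 ler_piMl.
lra.
Qed.

End lyapunov_function.

(** * Drift estimates *)

Section drift.
Context {R : realType} {S : finType} {s0 : S}.
Local Notation T := (strip R s0).
Variables (Sigma : set T) (K : transition_law R s0) (p Cp : R).
Variables (q gamma dd : S -> S -> R) (d e t2 a : S -> R).
Hypothesis lawK : law_on Sigma K.
Hypothesis p2 : 2 < p.
Hypothesis momC : forall x i, Sigma (x, i) ->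
  (Eincr K i x (fun D _ => (`|D| `^ p)%R) <= Cp%:E)%E.
Hypothesis q_cvg : forall i j, qj K i j =
  (fun x => q i j + gamma i j / x) +o_ (line_infty Sigma i) (fun x => x^-1).
Hypothesis mu_cvg : forall i, mu K i =
  (fun x => d i + e i / x) +o_ (line_infty Sigma i) (fun x => x^-1).
Hypothesis sigma2_cvg : forall i, sigma2 K i =
  (fun=> t2 i) +o_ (line_infty Sigma i) (fun=> 1 : R).
Hypothesis muj_cvg : forall i j, muj K i j =
  (fun=> dd i j) +o_ (line_infty Sigma i) (fun=> 1 : R).
Hypothesis q1 : forall i, \sum_j q i j = 1.
Hypothesis a_eq : forall i, d i + \sum_j (a j - a i) * q i j = 0.

#[local] Instance drift_filter i : Filter (line_infty Sigma i).
Proof. exact: within_filter. Qed.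

(** The drift of x + a_i, in which the constant term d_i has been cancelled. *)
Let delta i x := \sum_j a j * qj K i j x - a i + mu K i x.

Let delta_cvg i : x * delta i x @[x --> line_infty Sigma i] -->
  e i + \sum_j a j * gamma i j.
Proof.
have -> : (fun x => x * delta i x) =
    (fun x => x * (mu K i x - d i) + \sum_j a j * (x * (qj K i j x - q i j))).
  apply/funext => x.
  have -> : \sum_j a j * (x * (qj K i j x - q i j)) =
      x * (\sum_j a j * qj K i j x - \sum_j a j * q i j).
    by rewrite -sumrB mulr_sumr; apply: eq_bigr => j _; ring.
  have := a_eq i.
  under eq_bigr do rewrite mulrBl.
  rewrite sumrB -mulr_sumr q1 mulr1 => ai.
  rewrite /delta -mulrDr; congr (_ * _); lra.
apply: cvgD; first exact: littleo_inv_cvg (mu_cvg i).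
apply: cvg_line_sum => j; apply: cvgM; first exact: cvg_cst.
exact: littleo_inv_cvg (q_cvg i j).
Qed.

Let weighted_q_cvg (b : S -> R) i :
  \sum_j b j * qj K i j x @[x --> line_infty Sigma i] --> \sum_j b j * q i j.
Proof.
apply: cvg_line_sum => j; apply: cvgM; first exact: cvg_cst.
exact: littleo_inv_cvg_cst (q_cvg i j).
Qed.

Let weighted_muj_cvg i :
  \sum_j a j * muj K i j x @[x --> line_infty Sigma i] --> \sum_j a j * dd i j.
Proof.
apply: cvg_line_sum => j; apply: cvgM; first exact: cvg_cst.
exact: littleo_cst_cvg (muj_cvg i j).
Qed.

(** The left-hand side of the hypothesis on b is the coefficient of x ^ (nu - 2)
    in the drift of the Lyapunov function on line i. *)
Lemma lyapunov_submartingale (nu kappa : R) (b : S -> R) : 0 < kappa ->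
  (forall i, nu * (e i + \sum_j a j * gamma i j)
    + (\sum_j b j * q i j - b i + nu * (nu - 1) * \sum_j a j * dd i j
       + nu * (nu - 1) / 2 * t2 i) = kappa) ->
  exists2 M, 1 <= M & forall w, Sigma w -> M <= w.1 ->
    ((lyapunov nu a b w)%:E <= \int[K w]_v (lyapunov nu a b v)%:E)%E.
Proof.
move=> kappa0 b_eq.
(* The Taylor remainder is cubic, so higher moments do not improve the error. *)
pose pm := Num.min p 3.
have pm2 : 2 < pm by rewrite /pm lt_min p2/=; lra.
have pm3 : pm <= 3 by rewrite /pm ge_min lexx orbT.
have pmp : pm <= p by rewrite /pm ge_min lexx.
have [C C0 HC] := lyapunov_expansion (s0 := s0) nu a b pm2 pm3.
have [M1 M11 HM1] := lyapunov_lower (s0 := s0) nu a b.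
(* A lower bound for the drift, divided by x ^ (nu - 2). *)
pose Phi i x := nu * (x * delta i x)
  + (\sum_j b j * qj K i j x - b i + nu * (nu - 1) * \sum_j a j * muj K i j x
     + nu * (nu - 1) / 2 * sigma2 K i x)
  - C * (1 + Cp) * (x `^ (- (pm - 2)) + 2 * x^-1).
have Phi_cvg i : Phi i x @[x --> line_infty Sigma i] --> kappa.
  have -> : kappa = kappa - C * (1 + Cp) * (0 + 2 * 0).
    by rewrite mulr0 addr0 mulr0 subr0.
  rewrite -{1}(b_eq i).
  apply: cvgB.
    apply: cvgD; first by apply: cvgM; [exact: cvg_cst|exact: delta_cvg].
    apply: cvgD; last first.
      by apply: cvgM; [exact: cvg_cst|exact: littleo_cst_cvg (sigma2_cvg i)].
    apply: cvgD; last by apply: cvgM; [exact: cvg_cst|exact: weighted_muj_cvg].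
    by apply: cvgB; [exact: weighted_q_cvg|exact: cvg_cst].
  apply: cvgM; first exact: cvg_cst.
  apply: cvgD; first by apply: cvg_powR_line; rewrite subr_gt0.
  by apply: cvgM; [exact: cvg_cst|exact: cvg_inv_line].
have Phi_ge0 i : \forall x \near line_infty Sigma i, 0 <= Phi i x.
  exact: cvgr_ge (Phi_cvg i) _ kappa0.
have [M2 M21 HM2] := near_lines Phi_ge0.
exists (M1 + M2 + 1); first lra.
move=> [x i] Sxi /= Mx.
have x2 : 2 <= x by lra.
have x0 : 0 < x by lra.
have {HM2} Phi0 : 0 <= Phi i x by apply: HM2 => //; lra.
have [|_ hE] := HM1 (x, i); first by rewrite /=; lra.
rewrite {}hE /=.
have mom := momC Sxi.
have [|u1 m1 u1C] := step_moment mom (r := pm).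
  by rewrite pmp andbT (le_trans _ (ltW pm2)).
have [|u2 m2 u2C] := step_moment mom (r := 2); first by rewrite ler0n ltW.
have [|u3 m3 u3C] := step_moment mom (r := 1).
  by rewrite ler01 (le_trans _ (ltW p2))// ler1n.
pose X := x `^ nu; pose r := x^-1.
have r0 : 0 < r by rewrite invr_gt0.
have X0 : 0 < X by exact: powR_gt0.
have quad := has_mean_quadratic p2 mom
  (fun j => X * (1 + nu * a j * r + b j * r ^+ 2))
  (fun j => X * (nu * (nu - 1) * a j * r ^+ 2))
  (X * nu * r) (X * (nu * (nu - 1) / 2) * r ^+ 2).
have err := has_meanZ (- (X * C)) (has_meanD (has_meanD
  (has_meanZ (r `^ pm) m1) (has_meanZ (r ^+ 3) m2)) (has_meanZ (r ^+ 3) m3)).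
have tot := has_meanD quad err.
refine (le_trans _ (has_mean_le _ (lawK Sxi) _ tot _ _)) => //.
- rewrite lee_fin.
  have -> : \sum_j X * (1 + nu * a j * r + b j * r ^+ 2) * qj K i j x =
      X * (1 + nu * r * (\sum_j a j * qj K i j x)
           + r ^+ 2 * (\sum_j b j * qj K i j x)).
    transitivity (X * (\sum_j qj K i j x + nu * r * (\sum_j a j * qj K i j x)
           + r ^+ 2 * (\sum_j b j * qj K i j x))); last by rewrite (sum_qj mom).
    rewrite [in RHS]mulr_sumr [in RHS]mulr_sumr -!big_split/= mulr_sumr.
    by apply: eq_bigr => j _; ring.
  have -> : \sum_j X * (nu * (nu - 1) * a j * r ^+ 2) * muj K i j x =
      X * (r ^+ 2 * (nu * (nu - 1) * \sum_j a j * muj K i j x)).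
    by rewrite !mulr_sumr; apply: eq_bigr => j _; ring.
  have rpm : r `^ pm = r ^+ 2 * x `^ (- (pm - 2)).
    have -> : r ^+ 2 = x `^ (- 2) by rewrite powR_invn ?(ltW x0)// -exprVn.
    rewrite -powRD; last by rewrite (gt_eqF x0) implybT.
    by rewrite /r -powR_inv1 ?(ltW x0)// -powRrM; congr (_ `^ _); ring.
  apply: (@le_trans _ _ (X * (1 + nu * a i * r + b i * r ^+ 2)
     + X * r ^+ 2 * Phi i x)).
    by rewrite lerDl mulr_ge0// mulr_ge0 ?sqr_ge0// ltW.
  have E : X * C * (r `^ pm * u1 + r ^+ 3 * u2 + r ^+ 3 * u3) <=
      X * C * (r `^ pm * (1 + Cp) + r ^+ 3 * (1 + Cp) + r ^+ 3 * (1 + Cp)).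
    rewrite ler_wpM2l ?mulr_ge0 ?(ltW X0)//.
    have r30 : 0 <= r ^+ 3 by rewrite exprn_ge0 ?ltW.
    by rewrite !lerD// ler_wpM2l ?powR_ge0.
  rewrite -[leRHS]/(_ + _) mulNr -lerBlDr opprK.
  apply: (le_trans (lerD (lexx _) E)).
  rewrite rpm /Phi /delta -/r le_eqVlt; apply/orP; left; apply/eqP.
  have rx : r * x = 1 by rewrite /r mulVf// gt_eqF.
  set SA := \sum_j a j * qj K i j x; set SB := \sum_j b j * qj K i j x.
  set SM := \sum_j a j * muj K i j x; set xp := x `^ _.
  have -> : X * r ^+ 2 * (nu * (x * (SA - a i + mu K i x)) +
      (SB - b i + nu * (nu - 1) * SM + nu * (nu - 1) / 2 * sigma2 K i x) -
      C * (1 + Cp) * (xp + 2 * r)) =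
    X * (nu * (r * x * r * (SA - a i + mu K i x)) + r ^+ 2 *
      (SB - b i + nu * (nu - 1) * SM + nu * (nu - 1) / 2 * sigma2 K i x) -
      r ^+ 2 * C * (1 + Cp) * (xp + 2 * r)) by ring.
  by rewrite rx; field.
- by move=> w; rewrite lee_fin lyapunov_ge0.
- move=> w _; rewrite lee_fin; apply: le_trans (HC x w x2).
  rewrite -/r -/X /= normrM (ger0_norm (ltW r0)) powRM ?(ltW r0)//.
  rewrite le_eqVlt; apply/orP; left; apply/eqP.
  rewrite powRr1// powR_mulrn// real_normK ?num_real//.
  by field.
Qed.

(** At level v the drift of x + a_i is O (1 / v), while the displacement that it
    multiplies is O (v) as long as v >= y / 2: the squared displacement grows by
    a bounded amount per step on average. *)
Lemma square_displacement : exists2 Q, 0 < Q & exists2 M, 1 <= M &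
  forall y i0 v i, Sigma (v, i) -> M <= v -> 0 <= y -> y <= 2 * v ->
  exists2 u, has_mean (K (v, i)) (fun w => (w.1 + a w.2 - (y + a i0)) ^+ 2) u &
    u <= (v + a i - (y + a i0)) ^+ 2 + Q.
Proof.
pose A := \sum_i `|a i|.
have aA i : `|a i| <= A by rewrite /A (bigD1 i)//= lerDl sumr_ge0.
have A0 : 0 <= A by exact: sumr_ge0.
pose l i := e i + \sum_j a j * gamma i j.
pose rest i x := \sum_j a j ^+ 2 * qj K i j x - a i ^+ 2
  + 2 * (\sum_j a j * muj K i j x) + sigma2 K i x.
pose l' i := \sum_j a j ^+ 2 * q i j - a i ^+ 2
  + 2 * (\sum_j a j * dd i j) + t2 i.
have rest_cvg i : rest i x @[x --> line_infty Sigma i] --> l' i.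
  apply: cvgD; last exact: littleo_cst_cvg (sigma2_cvg i).
  apply: cvgD; last by apply: cvgM; [exact: cvg_cst|exact: weighted_muj_cvg].
  by apply: cvgB; [exact: weighted_q_cvg|exact: cvg_cst].
have bounded i : \forall x \near line_infty Sigma i,
    `|x * delta i x| <= `|l i| + 1 /\ `|rest i x| <= `|l' i| + 1.
  near=> x; split; near: x.
    apply: (@cvgr_norm_le _ R^o _ _ _ (fun x => x * delta i x) (l i)) => //.
    by rewrite ltrDl.
  by apply: (@cvgr_norm_le _ R^o _ _ _ (rest i) (l' i)) => //; rewrite ltrDl.
have [M M1 HM] := near_lines bounded.
pose L := \sum_i (`|l i| + 1); pose L' := \sum_i (`|l' i| + 1).
have L0 : 0 <= L by apply: sumr_ge0 => i _; rewrite addr_ge0.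
have L'0 : 0 <= L' by apply: sumr_ge0 => i _; rewrite addr_ge0.
exists (2 * (3 + A) * L + L' + 1).
  by rewrite ltr_pwDr// addr_ge0// mulr_ge0// mulr_ge0// addr_ge0.
exists M => // y i0 v i Svi Mv y0 yv.
have mom := momC Svi.
have [dB rB] := HM i v Mv Svi.
have v0 : 0 < v by lra.
pose z := v - (y + a i0).
have mean := has_mean_quadratic p2 mom
  (fun j => (a j + z) ^+ 2) (fun j => 2 * a j) (2 * z) 1.
eexists.
  have -> : (fun w : T => (w.1 + a w.2 - (y + a i0)) ^+ 2) =
    (fun w : T => (a w.2 + z) ^+ 2 + 2 * z * (w.1 - v)
       + 2 * a w.2 * (w.1 - v) + 1 * (w.1 - v) ^+ 2).
    by apply/funext => w; rewrite /z; ring.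
  exact: mean.
have -> : \sum_j (a j + z) ^+ 2 * qj K i j v =
    \sum_j a j ^+ 2 * qj K i j v + 2 * z * (\sum_j a j * qj K i j v) + z ^+ 2.
  transitivity (\sum_j a j ^+ 2 * qj K i j v + 2 * z * (\sum_j a j * qj K i j v)
      + z ^+ 2 * \sum_j qj K i j v); last by rewrite (sum_qj mom) mulr1.
  by rewrite !mulr_sumr -!big_split/=; apply: eq_bigr => j _; ring.
have -> : \sum_j 2 * a j * muj K i j v = 2 * \sum_j a j * muj K i j v.
  by rewrite mulr_sumr; apply: eq_bigr => j _; ring.
have -> : (v + a i - (y + a i0)) ^+ 2 = (a i + z) ^+ 2 by rewrite /z; ring.
have zv : `|z| <= (3 + A) * v.
  rewrite /z opprD addrA (le_trans (ler_normB _ _))//.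
  have := aA i0; have : A <= A * v by rewrite ler_peMr//; lra.
  have : `|v - y| <= 3 * v by rewrite ler_norml; lra.
  lra.
have H1 : 2 * z * delta i v <= 2 * (3 + A) * L.
  apply: (le_trans (ler_norm _)); rewrite -!mulrA normrM (ger0_norm (ler0n R 2)).
  rewrite ler_wpM2l// normrM.
  apply: (@le_trans _ _ ((3 + A) * v * `|delta i v|)); first by rewrite ler_wpM2r.
  rewrite -mulrA ler_wpM2l//; first lra.
  rewrite -[v in v * _](gtr0_norm v0) -normrM (le_trans dB)//.
  by rewrite /L (bigD1 i)//= lerDl sumr_ge0// => j _; rewrite addr_ge0.
have H2 : rest i v <= L'.
  apply: (le_trans (ler_norm _)); apply: (le_trans rB).
  by rewrite /L' (bigD1 i)//= lerDl sumr_ge0// => j _; rewrite addr_ge0.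
move: H1 H2; rewrite /delta /rest; lra.
Unshelve. all: by end_near. Qed.

(** Diffusive lower bound on the passage time: by a Chebyshev estimate for the
    squared displacement, descending from y to y / 2 takes of order y ^ 2
    steps with probability at least one half. *)
Lemma survival_quadratic : exists2 eps, 0 < eps & exists2 B, 1 <= B &
  forall x w N, Sigma w -> B <= w.1 -> 2 * x <= w.1 ->
  N%:R <= eps * w.1 ^+ 2 -> ((2^-1)%:E <= survival K x N w)%E.
Proof.
have [Q Q0 [M M1 HQ]] := square_displacement.
pose A := \sum_i `|a i|.
have aA i : `|a i| <= A by rewrite /A (bigD1 i)//= lerDl sumr_ge0.
have A0 : 0 <= A by exact: sumr_ge0.
exists (32 * Q)^-1; first by rewrite invr_gt0 mulr_gt0.
exists (2 * M + 8 * A); first lra.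
move=> x w N Sw Bw xw NQ.
pose y := w.1; pose G v := (v.1 + a v.2 - (y + a w.2)) ^+ 2.
pose H := y ^+ 2 / 16.
have y0 : 0 < y by rewrite /y; lra.
have H0 : 0 < H by rewrite divr_gt0// exprn_gt0.
have G0 v : 0 <= G v by exact: sqr_ge0.
have Hlow (v : T) : v.1 <= y / 2 -> H <= G v.
  move=> vy; have := aA v.2; have := aA w.2; rewrite !ler_norml.
  move=> /andP[? ?] /andP[? ?].
  have yB : 2 * M + 8 * A <= y by [].
  have h : y / 4 <= - (v.1 + a v.2 - (y + a w.2)) by lra.
  rewrite /H /G -[leRHS]sqrrN.
  have -> : y ^+ 2 / 16 = (y / 4) ^+ 2 by field.
  by rewrite lerXn2r// nnegrE; lra.
(* Chebyshev along the recursion for the survival probability: G grows by at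
   most Q on average per step while v.1 > y / 2, and G >= H below y / 2. *)
have claim n v : Sigma v ->
    ((1 - (G v + Q * n%:R) / H)%:E <= survival K x n v)%E.
  elim: n v => [|n IH] v Sv; have [vy|vy] := leP v.1 (y / 2).
  - apply: (@le_trans _ _ 0%E); last exact: survival_ge0.
    rewrite lee_fin subr_le0 mulr0 addr0 ler_pdivlMr// mul1r; exact: Hlow.
  - rewrite survival0; last by rewrite -/y in xw; lra.
    by rewrite lee_fin gerBl mulr_ge0// ?invr_ge0 ?(ltW H0)// mulr0 addr0.
  - apply: (@le_trans _ _ 0%E); last exact: survival_ge0.
    rewrite lee_fin subr_le0 ler_pdivlMr// mul1r.
    by rewrite (le_trans (Hlow _ vy))// lerDl mulr_ge0// ltW.
  - rewrite survivalS; last by rewrite -/y in xw; lra.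
    have yB : 2 * M + 8 * A <= y by [].
    case: v Sv vy => v i Sv /= vy.
    have [||||u um uQ] := HQ y w.2 v i; [by []|lra|exact: ltW|lra|].
    have mean := has_meanD (has_mean_cst _ (1 - Q * n%:R / H)) (has_meanZ (- H^-1) um).
    refine (le_trans _ (has_mean_le _ (lawK Sv) _ mean _ _)) => //.
    + rewrite lee_fin -natr1.
      have : H^-1 * u <= H^-1 * (G (v, i) + Q).
        by rewrite ler_wpM2l ?invr_ge0 ?(ltW H0).
      rewrite /G /=; set g := (_ - _) ^+ 2 => h.
      have -> : (g + Q * (n%:R + 1)) / H = H^-1 * (g + Q) + Q * n%:R / H by ring.
      lra.
    + by move=> z; exact: survival_ge0.
    + move=> z Sz; apply: le_trans (IH z Sz); rewrite lee_fin /G.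
      by rewrite le_eqVlt; apply/orP; left; apply/eqP; ring.
apply: le_trans (claim N w Sw); rewrite lee_fin.
have -> : G w = 0 by rewrite /G subrr expr0n.
suff : Q * N%:R / H <= 2^-1 by rewrite add0r; lra.
rewrite ler_pdivrMr//.
apply: (@le_trans _ _ (Q * ((32 * Q)^-1 * y ^+ 2))); first by rewrite ler_wpM2l// ltW.
by rewrite le_eqVlt; apply/orP; left; apply/eqP; rewrite /H; field; rewrite gt_eqF.
Qed.

End drift.

(** * Infinite moments of the passage time *)

(** Averaging the second order drift coefficients over the stationary
    distribution leaves a multiple of the quantity assumed to be positive. *)
Lemma lyapunov_constant (R : realType) (S : finType) (e t2 a pi : S -> R)
    (gamma dd : S -> S -> R) (theta : R) :
  \sum_k pi k * (2 * theta * (e k + \sum_j a j * gamma k j)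
    + (2 * theta * (2 * theta - 1) * \sum_j a j * dd k j
       + 2 * theta * (2 * theta - 1) / 2 * t2 k)) =
  theta * (Uconst e a pi gamma + (2 * theta - 1) * Vconst t2 a pi dd).
Proof.
rewrite /Uconst /Vconst mulr_sumr -big_split/= mulr_sumr.
by apply: eq_bigr => k _; field.
Qed.


Theorem theorem3p2p4 (R : realType) (S : finType) (s0 : S)
  (Sigma : set (strip R s0)) (K : transition_law R s0)
  (p : R) (q gamma dd : S -> S -> R) (pi d e t2 a : S -> R) (theta : R) :
  half_strip Sigma ->
  law_on Sigma K ->
  irreducible_law Sigma K ->
  2 < p ->
  (exists C : R, forall x i, Sigma (x, i) ->
    (Eincr K i x (fun D _ => (`|D| `^ p)%R) <= C%:E)%E) ->
  (forall i j, qj K i j =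
    (fun x => q i j + gamma i j / x) +o_ (line_infty Sigma i) (fun x => x^-1)) ->
  stochastic q ->
  irreducible_matrix q ->
  stationary q pi ->
  (forall i, 0 <= t2 i) ->
  (exists i, t2 i != 0) ->
  (forall i, mu K i =
    (fun x => d i + e i / x) +o_ (line_infty Sigma i) (fun x => x^-1)) ->
  (forall i, sigma2 K i =
    (fun=> t2 i) +o_ (line_infty Sigma i) (fun=> 1 : R)) ->
  (forall i j, muj K i j =
    (fun=> dd i j) +o_ (line_infty Sigma i) (fun=> 1 : R)) ->
  \sum_i pi i * d i = 0 ->
  (forall i, d i + \sum_j (a j - a i) * q i j = 0) ->
  0 < theta -> theta <= p / 2 ->
  0 < Uconst e a pi gamma + (2 * theta - 1) * Vconst t2 a pi dd ->
  forall s : R, theta <= s ->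
  exists x0 : R, forall x, x0 <= x ->
  exists2 y : R, x <= y & forall z0 : strip R s0, Sigma z0 -> y < z0.1 ->
  forall (dO : measure_display) (Omega : measurableType dO)
    (P : probability Omega R) (Z : nat -> {RV P >-> strip R s0}),
  markov_chain Sigma K z0 Z ->
  (\int[P]_w (tau (fun n => (Z n w).1) x `^ s) = +oo)%E.
Proof.
move=> HS lawK _ p2 [Cp momC] q_cvg sq iq pi_stat _ _ mu_cvg sigma2_cvg muj_cvg.
move=> _ a_eq theta0 _ UV0 s thetas.
have momC' x i : Sigma (x, i) ->
  (Eincr K i x (fun D _ => (`|D| `^ p)%R) <= Cp%:E)%E by exact: momC.
have [_ q1] := sq.
pose nu := 2 * theta.
have nu0 : 0 < nu by rewrite mulr_gt0.
have [b b_eq] := poisson_equation (fun k => nu * (e k + \sum_j a j * gamma k j)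
    + (nu * (nu - 1) * \sum_j a j * dd k j + nu * (nu - 1) / 2 * t2 k)) sq iq pi_stat.
pose kappa := theta * (Uconst e a pi gamma + (2 * theta - 1) * Vconst t2 a pi dd).
have kappa0 : 0 < kappa by exact: mulr_gt0.
have [|M M1 h_sub] := lyapunov_submartingale lawK p2 momC' q_cvg mu_cvg sigma2_cvg
  muj_cvg q1 a_eq (nu := nu) (b := b) kappa0.
  move=> i; rewrite /kappa -lyapunov_constant -/nu -(b_eq i).
  have -> : \sum_j b j * q i j = \sum_j q i j * b j.
    by apply: eq_bigr => j _; rewrite mulrC.
  by ring.
have [M' M'1 h_low] := lyapunov_lower (s0 := s0) nu a b.
have [C C0 h_up] := lyapunov_upper (s0 := s0) a b nu0.
have [eps eps0 [B B1 surv]] := survival_quadratic lawK p2 momC' q_cvg mu_cvg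
  sigma2_cvg muj_cvg q1 a_eq.
set h := lyapunov nu a b in h_sub h_low h_up.
have h0 w : 0 <= h w by exact: lyapunov_ge0.
exists M => x Mx; have x1 : 1 <= x by lra.
pose m := C * x `^ nu.
have m0 : 0 <= m by rewrite mulr_ge0 ?powR_ge0// ltW.
(* Above this level h > m, since h (y, i) >= y ^ nu / 2 for y >= M'. *)
exists (x + M' + (2 * m) `^ nu^-1).
  by rewrite -addrA lerDl addr_ge0 ?powR_ge0//; lra.
move=> z0 Sz0 yz0 dO Omega P Z chainZ.
have s_gt0 : 0 < s by exact: lt_le_trans thetas.
pose g w := Num.max 0 (h w - m).
(* From above B' the return time is of order the square of the level; below B'
   the function g is bounded and surviving zero more steps is enough. *)
pose B' := B + 2 * x.
have hB (c : R) w : 1 <= c -> w.1 <= c -> g w <= C * c `^ nu.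
  move=> c1 wc; rewrite /g ge_max mulr_ge0 ?powR_ge0 ?(ltW C0)//=.
  by rewrite lerBlDr (le_trans (h_up c w c1 wc))// lerDl.
apply: (@passage_moment_infinite R S s0 Sigma K z0 dO Omega P Z
  (half_strip_countable HS) lawK chainZ x s
  (C * B' `^ nu + C * eps `^ (- theta)) g) => //.
- by rewrite ltr_wpDr ?mulr_ge0 ?powR_ge0 ?(ltW C0)// mulr_gt0// powR_gt0// /B'; lra.
- by move=> w; rewrite /g le_max lexx.
- by move=> w wx; rewrite /g max_l// subr_le0 h_up.
- move=> w Sw xw; rewrite {1}/g; case: (leP (h w - m) 0) => hm.
    by apply: integral_ge0 => v _; rewrite lee_fin le_max lexx.
  have hw : ((h w)%:E <= \int[K w]_v (h v)%:E)%E by apply: h_sub => //; lra.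
  rewrite EFinB leeBlDr//; apply: (le_trans hw).
  have -> : (m%:E = \int[K w]_v (cst m%:E) v)%E.
    by rewrite integral_cst//= probability_setT mule1.
  rewrite -ge0_integralD//.
  + apply: ge0_le_integral => //.
    * by move=> v _; rewrite lee_fin.
    * by move=> v _; rewrite /= lee_fin /g -lerBlDr le_max lexx orbT.
  + by move=> v _; rewrite lee_fin le_max lexx.
- move=> w Sw xw; have x0 : 0 < w.1 by lra.
  have [wB|Bw] := leP w.1 B'.
    exists 0%N; split; last first.
      by rewrite survival0// lee_fin invf_le1// ler1n.
    rewrite powR1 mulr1 (le_trans (hB B' w _ wB))//; first by rewrite /B'; lra.
    by rewrite lerDl mulr_ge0 ?powR_ge0// ltW.
  pose N := Num.truncn (eps * w.1 ^+ 2).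
  have ew0 : 0 <= eps * w.1 ^+ 2 by rewrite mulr_ge0 ?sqr_ge0// ltW.
  exists N; split; last first.
    by apply: surv => //; rewrite ?truncn_le//; rewrite /B' in Bw; lra.
  have wN : eps * w.1 ^+ 2 <= N.+1%:R by apply/ltW/truncnS_gt.
  apply: (@le_trans _ _ (C * w.1 `^ nu)); first by apply: hB => //; lra.
  have -> : w.1 `^ nu = eps `^ (- theta) * (eps * w.1 ^+ 2) `^ theta.
    rewrite powRM ?sqr_ge0 ?(ltW eps0)// mulrA -powRD; last first.
      by rewrite (gt_eqF eps0) implybT.
    rewrite addNr powRr0 mul1r -powR_mulrn ?(ltW x0)// -powRrM //.
  rewrite mulrA mulrDl; apply: ler_wpDl.
    by rewrite !mulr_ge0 ?powR_ge0// ltW.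
  rewrite ler_wpM2l ?mulr_ge0 ?powR_ge0 ?(ltW C0)//.
  apply: (@le_trans _ _ (N.+1%:R `^ theta)).
    by apply: ge0_ler_powR; rewrite ?nnegrE ?(ltW theta0) ?ler0n.
  by apply: ler_powR; rewrite ?ler1n.
- have k0 : 0 <= (2 * m) `^ nu^-1 by exact: powR_ge0.
  have zM' : M' <= z0.1 by lra.
  have [h1 _] := h_low z0 zM'.
  rewrite /g lt_max; apply/orP; right; rewrite subr_gt0.
  apply: lt_le_trans h1; rewrite ltr_pdivlMr// mulrC.
  have -> : 2 * m = ((2 * m) `^ nu^-1) `^ nu.
    rewrite -powRrM mulVf ?gt_eqF// powRr1//; lra.
  by apply: gt0_ltr_powR; rewrite ?nnegrE//; lra.
Qed.
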